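(* Let $\Phi:Z\to S$ be any flat holomorphic map between complex manifolds. Then there exist a function $r: Z\to \mathbb{R}_{>0}$, $z\mapsto r(z)$, and, for all $z\in Z$ and all real $r$ with $0<r< r(z)$, a relative chart $j_z:U_z(r)\to D_z(r)\times S_z$ for $\Phi$, such that 1) $j_z(z)$ is independent of $r$, and 2) $p_1\circ j_z: U_z(r)\to D_z(r)$ is a bijection mapping $z$ to the center of the polycylinder $D_z(r)$ of radius $r$, where $p_1$ is the projection to the first factor. Furthermore, any finite intersection of these relative charts is a complete intersection.
   Context: Manifolds are connected, paracompact and Hausdorff. Put $n:=\dim_{\mathbb{C}} Z-\dim_{\mathbb{C}} S$; it is assumed that $n>0$. A polycylinder of radius $r$ is a domain $D(r)=\{(z_1,\dots,z_m)\in\mathbb{C}^m : |z_i-a_i|<r\ (i=1,\dots,m)\}$; $(a_1,\dots,a_m)$ is its center. A relative chart for $\Phi$ is a closed holomorphic embedding $j:U\to D(r)\times S_U$, where $U\subset Z$ is an open subset (possibly empty), $S_U\subset S$ is an open subset with $\Phi(U)\subset S_U$, $D(r)$ is a polycylinder of radius $r$ in some $\mathbb{C}^m$ ($m\ge 0$), and $pr_{S_U}\circ j=\Phi|_U$. A relative chart is called a complete intersection if there is a sequence $f_1,\dots,f_l$ of holomorphic functions on $D(r)\times S_U$, with $l=m+\dim_{\mathbb{C}}S-\dim_{\mathbb{C}}Z=m-n$ the codimension of $U$, such that $j$ induces an isomorphism $j^*:\mathcal{O}_{D(r)\times S_U}/(f_1,\dots,f_l)\simeq\mathcal{O}_U$.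 For a finite nonempty family of relative charts $j_k:U_k\to D_k\times S_k$ ($k\in K$), their intersection is the fiber product over $S_K:=\bigcap_{k\in K}S_k$, i.e. the map $j_K:U_K:=\bigcap_{k\in K}U_k\to D_K\times S_K$, $D_K:=\prod_{k\in K}D_k$, whose component in each $D_k$ is the $D_k$-component of $j_k$ and whose component in $S_K$ is $\Phi$. The factors $D_k$ may have different radii; the intersection $j_K$ is called a complete intersection if there is a sequence $f_1,\dots,f_l$ of holomorphic functions on $D_K\times S_K$, with $l=\dim_{\mathbb{C}} D_K+\dim_{\mathbb{C}}S-\dim_{\mathbb{C}}Z=\dim_{\mathbb{C}} D_K-n$, such that $j_K$ induces an isomorphism $j_K^*:\mathcal{O}_{D_K\times S_K}/(f_1,\dots,f_l)\simeq\mathcal{O}_{U_K}$. *)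

(* Defs.v *)
From HB Require Import structures.
From mathcomp Require Import all_boot all_order all_algebra.
From mathcomp Require Export complex.
From mathcomp Require Import all_classical all_reals all_analysis.

Set Implicit Arguments.
Unset Strict Implicit.
Unset Printing Implicit Defensive.

Import Order.TTheory GRing.Theory Num.Theory numFieldNormedType.Exports.

Local Open Scope classical_set_scope.
Local Open Scope ring_scope.
Local Open Scope quotient_scope.

(* The complex numbers. The topological structures of MathComp-Analysis are
   attached to an arbitrary [numClosedFieldType] and are not found on [R[i]]
   itself, whence the explicit packaging. *)
Definition Cx (R : realType) : numClosedFieldType := R[i].

Section NearDifferentiable.
Variables (K : numFieldType) (V W : normedModType K).

Lemma differentiable_intro (f : V -> W) (df : {linear V -> W}) (x : V) :
  continuous df -> f \o shift x = cst (f x) + df +o_ 0 id ->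
  differentiable f x.
Proof.
move=> cdf edf; have dE := diff_unique cdf edf.
by apply/diff_locallyP; rewrite dE.
Qed.

Lemma near_eq_differentiable (f g : V -> W) (x : V) :
  (\forall y \near x, f y = g y) -> differentiable f x -> differentiable g x.
Proof.
move=> fg df; have fgx : f x = g x by exact: nbhs_singleton fg.
apply: (@differentiable_intro g ('d f x)); first exact: diff_continuous.
have /eqaddoP H := diff_locally df.
apply/eqaddoP => e e0; move: fg (H e e0); rewrite (near_shift 0 x) subr0.
by apply: filterS2 => y; rewrite /= !fctE /= -fgx => ->.
Qed.

End NearDifferentiable.

Section Flat.
Variables (A B : comPzRingType) (phi : {rmorphism A -> B}).

(* The tensor product of M and B over A, B being an A-algebra through phi:
   finite formal sums of pure tensors, encoded as sequences of pairs, up to the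
   congruence [tensor_eq]. Opposites come for free, since (- m) (x) b is the
   opposite of m (x) b. *)
Inductive tensor_eq (M : lmodType A) : seq (M * B) -> seq (M * B) -> Prop :=
| tensor_refl s : tensor_eq s s
| tensor_sym s t : tensor_eq s t -> tensor_eq t s
| tensor_trans s t u : tensor_eq s t -> tensor_eq t u -> tensor_eq s u
| tensor_cat s s' t t' :
    tensor_eq s s' -> tensor_eq t t' -> tensor_eq (s ++ t) (s' ++ t')
| tensor_comm s t : tensor_eq (s ++ t) (t ++ s)
| tensor_zero b : tensor_eq [:: (0, b)] [::]
| tensor_addl m m' b : tensor_eq [:: (m + m', b)] [:: (m, b); (m', b)]
| tensor_addr m b b' : tensor_eq [:: (m, b + b')] [:: (m, b); (m, b')]
| tensor_scale a m b : tensor_eq [:: (a *: m, b)] [:: (m, phi a * b)].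

Definition tensor_map (M N : lmodType A) (f : M -> N) (s : seq (M * B)) :
  seq (N * B) := [seq (f x.1, x.2) | x <- s].

Definition flat_rmorphism := forall (M N : lmodType A) (f : {linear M -> N}),
  injective f -> forall s t : seq (M * B),
    tensor_eq (tensor_map f s) (tensor_map f t) -> tensor_eq s t.

End Flat.

Section Charts.
Variable R : realType.
Local Notation C := (Cx R).

(* A homeomorphism from an open subset of X onto an open subset of V;
   [fwd] and [bwd] are only meaningful on [dom] and [cod]. *)
Record chart (X : topologicalType) (V : normedModType C) := Chart {
  dom : set X;
  cod : set V;
  fwd : X -> V;
  bwd : V -> X;
  dom_open : open dom;
  cod_open : open cod;
  fwd_fun : forall x, dom x -> cod (fwd x);
  bwd_fun : forall v, cod v -> dom (bwd v);
  fwdK : forall x, dom x -> bwd (fwd x) = x;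
  bwdK : forall v, cod v -> fwd (bwd v) = v;
  fwd_continuous : forall x, dom x -> {for x, continuous fwd};
  bwd_continuous : forall v, cod v -> {for v, continuous bwd} }.

Record charted (V : normedModType C) := Charted {
  csort :> topologicalType;
  atlas : set (chart csort V);
  atlas_cover : forall x, exists2 c, atlas c & dom c x;
  atlas_compat : forall c c', atlas c -> atlas c' ->
    forall x, dom c x -> dom c' x ->
      differentiable (fwd c' \o bwd c) (fwd c x) }.

Definition cdiff_at (V W : normedModType C) (X : charted V) (Y : charted W)
    (f : X -> Y) (x : X) :=
  {for x, continuous f} /\
  forall c c', atlas c -> atlas c' -> dom c x -> dom c' (f x) ->
    differentiable (fwd c' \o f \o bwd c) (fwd c x).

(* This is holomorphy on A only when A is open. *)
Definition holomorphic_on (V W : normedModType C) (X : charted V)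
    (Y : charted W) (A : set X) (f : X -> Y) :=
  forall x, A x -> cdiff_at f x.

Definition holomorphic (V W : normedModType C) (X : charted V)
    (Y : charted W) (f : X -> Y) := holomorphic_on setT f.

Lemma bwd_near (X : topologicalType) (V : normedModType C) (c : chart X V)
    (x : X) (P : set X) : dom c x ->
  (\forall y \near x, P y) -> \forall v \near fwd c x, P (bwd c v).
Proof.
move=> cx Px; have := bwd_continuous (fwd_fun cx).
by rewrite /continuous_at /prop_for /= => h; apply: h; rewrite (fwdK cx).
Qed.

Lemma cdiff_at_comp (U V W : normedModType C) (X : charted U) (Y : charted V)
    (T : charted W) (f : X -> Y) (g : Y -> T) (x : X) :
  cdiff_at f x -> cdiff_at g (f x) -> cdiff_at (g \o f) x.
Proof.
move=> [fc fd] [gc gd]; split; first exact: continuous_comp.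
move=> c c'' Ac Ac'' cx c''x; have [c' Ac' c'x] := atlas_cover (f x).
have dg : differentiable (fwd c'' \o g \o bwd c')
    ((fwd c' \o f \o bwd c) (fwd c x)).
  by rewrite /= (fwdK cx); exact: gd.
apply: near_eq_differentiable (differentiable_comp (fd c c' Ac Ac' cx c'x) dg).
apply: (@bwd_near _ _ c x
  (fun y => fwd c'' (g (bwd c' (fwd c' (f y)))) = fwd c'' (g (f y)))) => //.
have : \forall y \near x, dom c' (f y).
  by apply: (fc (dom c')); apply: open_nbhs_nbhs; split=> //; exact: dom_open.
by apply: filterS => y c'y; rewrite fwdK.
Qed.

Section Euclid.
Variable V : normedModType C.

Program Definition id_chart : chart V V :=
  @Chart V V setT setT id id _ _ _ _ _ _ _ _.
Next Obligation. exact: openT. Qed.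
Next Obligation. exact: openT. Qed.
Next Obligation. by []. Qed.
Next Obligation. by []. Qed.
Next Obligation. by []. Qed.
Next Obligation. by []. Qed.
Next Obligation. by move=> *; exact: cvg_id. Qed.
Next Obligation. by move=> *; exact: cvg_id. Qed.

Program Definition euclid : charted V := @Charted V V [set id_chart] _ _.
Next Obligation. by move=> x; exists id_chart. Qed.
Next Obligation.
move=> _ _ -> -> x _ _; apply: (@linear_differentiable _ _ _ idfun).
by move=> ?; exact: cvg_id.
Qed.

End Euclid.

Section Product.
Variables (V W : normedModType C).

Lemma open_setX (X Y : topologicalType) (A : set X) (B : set Y) :
  open A -> open B -> open (A `*` B).
Proof.
move=> oA oB; rewrite openE => -[x y] [/= Ax By].
by exists (A, B) => //=; split; apply: open_nbhs_nbhs.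
Qed.

Section ProductChart.
Variables (X Y : topologicalType) (c : chart X V) (d : chart Y W).

Program Definition prod_chart : chart (X * Y)%type (V * W)%type :=
  @Chart (X * Y)%type (V * W)%type (dom c `*` dom d) (cod c `*` cod d)
    (fun p => (fwd c p.1, fwd d p.2)) (fun p => (bwd c p.1, bwd d p.2))
    _ _ _ _ _ _ _ _.
Next Obligation. by apply: open_setX; exact: dom_open. Qed.
Next Obligation. by apply: open_setX; exact: cod_open. Qed.
Next Obligation. by move=> [x y] [/= cx dy]; split; exact: fwd_fun. Qed.
Next Obligation. by move=> [v w] [/= cv dw]; split; exact: bwd_fun. Qed.
Next Obligation. by move=> [x y] [/= cx dy]; rewrite !fwdK. Qed.
Next Obligation. by move=> [v w] [/= cv dw]; rewrite !bwdK. Qed.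
Next Obligation.
move=> [x y] [/= cx dy]; apply: cvg_pair => /=.
  by apply: (@cvg_comp _ _ _ fst (fwd c)); [exact: cvg_fst|exact: fwd_continuous].
by apply: (@cvg_comp _ _ _ snd (fwd d)); [exact: cvg_snd|exact: fwd_continuous].
Qed.
Next Obligation.
move=> [v w] [/= cv dw]; apply: cvg_pair => /=.
  by apply: (@cvg_comp _ _ _ fst (bwd c)); [exact: cvg_fst|exact: bwd_continuous].
by apply: (@cvg_comp _ _ _ snd (bwd d)); [exact: cvg_snd|exact: bwd_continuous].
Qed.

End ProductChart.

Variables (X : charted V) (Y : charted W).

Program Definition prodc : charted (V * W)%type :=
  @Charted (V * W)%type (X * Y)%type
    [set p | exists c d, [/\ atlas c, atlas d & p = @prod_chart X Y c d]] _ _.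
Next Obligation.
move=> [x y]; have [c Ac cx] := atlas_cover x; have [d Ad dy] := atlas_cover y.
by exists (prod_chart c d); [exists c, d|split].
Qed.
Next Obligation.
move=> _ _ [c [d [Ac Ad ->]]] [c' [d' [Ac' Ad' ->]]] [x y] [/= cx dy] [/= cx' dy'].
apply: differentiable_pair.
  apply: (@differentiable_comp _ _ _ _ fst (fwd c' \o bwd c)).
    apply: (@linear_differentiable _ _ _ fst) => ?; exact: cvg_fst.
  exact: atlas_compat.
apply: (@differentiable_comp _ _ _ _ snd (fwd d' \o bwd d)).
  apply: (@linear_differentiable _ _ _ snd) => ?; exact: cvg_snd.
exact: atlas_compat.
Qed.

End Product.

Definition paracompact (X : topologicalType) := forall F : set (set X),
  F `<=` open -> \bigcup_(A in F) A = setT ->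
  exists G : set (set X),
    [/\ G `<=` open, \bigcup_(B in G) B = setT,
        forall B, G B -> exists2 A, F A & B `<=` A &
        forall x : X, exists2 N, nbhs x N &
          finite_set [set B | G B /\ B `&` N !=set0]].

Record complex_manifold (d : nat) := ComplexManifold {
  cm_charted :> charted 'rV[C]_d;
  cm_connected : connected [set: cm_charted];
  cm_hausdorff : hausdorff_space cm_charted;
  cm_paracompact : paracompact cm_charted }.


Definition cdiff_fun_at (V : normedModType C) (X : charted V) (f : X -> C)
  (x : X) := cdiff_at (Y := euclid C) f x.

Definition holomorphic_fun (V : normedModType C) (X : charted V) (A : set X)
  (f : X -> C) := forall x, A x -> cdiff_fun_at f x.

Section Germs.
Variables (V : normedModType C) (X : charted V) (x : X).

(* Representatives of germs at x: total functions that are holomorphic on some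
   neighbourhood of x. *)
Definition hol_near : {pred X -> C} :=
  fun f => `[< \forall y \near x, cdiff_fun_at f y >].

Lemma cdiff_fun_atE (f : X -> C) (y : X) : cdiff_fun_at f y <->
  {for y, continuous f} /\
  forall c, atlas c -> dom c y -> differentiable (f \o bwd c) (fwd c y).
Proof.
split=> -[fc fd]; (split; first exact: fc).
  by move=> c Ac cy; exact: (fd c (id_chart C) Ac erefl cy I).
by move=> c _ Ac -> cy _; exact: (fd c Ac cy).
Qed.

Lemma hol_near_subring : GRing.subring_closed hol_near.
Proof.
split.
- apply/asboolP; apply: nearW => y; apply/cdiff_fun_atE; split.
    exact: cst_continuous.
  by move=> c _ _; exact: (differentiable_cst (1 : C)).
- move=> f g /asboolP fh /asboolP gh; apply/asboolP.
  apply: filterS2 fh gh => y /cdiff_fun_atE[fc fd] /cdiff_fun_atE[gc gd].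
  apply/cdiff_fun_atE; split; first exact: cvgB fc gc.
  by move=> c Ac cy; apply: differentiableB; [exact: fd|exact: gd].
- move=> f g /asboolP fh /asboolP gh; apply/asboolP.
  apply: filterS2 fh gh => y /cdiff_fun_atE[fc fd] /cdiff_fun_atE[gc gd].
  apply/cdiff_fun_atE; split; first exact: cvgM fc gc.
  by move=> c Ac cy; apply: differentiableM; [exact: fd|exact: gd].
Qed.

HB.instance Definition _ :=
  GRing.isSubringClosed.Build (X -> C) hol_near hol_near_subring.

Record pregerm := Pregerm { pregerm_val :> X -> C;
                            pregermP : pregerm_val \in hol_near }.

HB.instance Definition _ := [isSub for pregerm_val].
HB.instance Definition _ := [Choice of pregerm by <:].
HB.instance Definition _ :=
  GRing.SubChoice_isSubComPzRing.Build (X -> C) hol_near pregerm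
    hol_near_subring.

Lemma pregerm_oner_neq0 : (1 : pregerm) != 0.
Proof.
apply/eqP => /(congr1 (fun f : pregerm => f x)) /eqP.
by rewrite /= oner_eq0.
Qed.

HB.instance Definition _ :=
  GRing.PzSemiRing_isNonZero.Build pregerm pregerm_oner_neq0.

Definition vanish_near : {pred pregerm} :=
  fun f => `[< \forall y \near x, f y = 0 >].

Lemma vanish_near_ideal : idealr_closed vanish_near.
Proof.
split.
- by apply/asboolP; exact: nearW.
- apply/asboolP => /nbhs_singleton /eqP; by rewrite /= oner_eq0.
- move=> a f g /asboolP f0 /asboolP g0; apply/asboolP.
  apply: filterS2 f0 g0 => y fy gy.
  by rewrite /= !fctE fy gy mulr0 addr0.
Qed.

HB.instance Definition _ := isIdealr.Build pregerm vanish_near vanish_near_ideal.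

Definition germ := {ideal_quot vanish_near}.
HB.instance Definition _ := GRing.ComNzRing.on germ.

End Germs.

Section Pullback.
Variables (V W : normedModType C) (X : charted V) (Y : charted W).
Variables (Phi : X -> Y) (hol_Phi : holomorphic Phi) (x : X).

Lemma pullback_subproof (f : pregerm (Phi x)) : f \o Phi \in hol_near x.
Proof.
apply/asboolP; have [Phic _] := hol_Phi (x := x) I.
have /asboolP fh := pregermP f.
have : \forall y \near x, cdiff_fun_at f (Phi y) by exact: Phic fh.
by apply: filterS => y fy; apply: cdiff_at_comp fy; exact: hol_Phi.
Qed.

Definition pregerm_pullback (f : pregerm (Phi x)) : pregerm x :=
  Pregerm (pullback_subproof f).

Definition germ_pullback (f : germ (Phi x)) : germ x :=
  \pi_(germ x) (pregerm_pullback (repr f)).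

Lemma germ_pullbackE (f : pregerm (Phi x)) :
  germ_pullback (\pi_(germ (Phi x)) f) = \pi_(germ x) (pregerm_pullback f).
Proof.
apply/eqP; rewrite /germ_pullback -Quotient.idealrBE; apply/asboolP.
have /eqP : \pi_(germ (Phi x)) (repr (\pi_(germ (Phi x)) f)) = \pi_(germ (Phi x)) f.
  exact: reprK.
rewrite -Quotient.idealrBE => /asboolP H.
by have [Phic _] := hol_Phi (x := x) I; exact: Phic H.
Qed.

Lemma germ_pullback_zmod : zmod_morphism germ_pullback.
Proof.
elim/quotW => f; elim/quotW => g.
rewrite -rmorphB !germ_pullbackE -rmorphB.
by congr (\pi_(germ x) _); exact: val_inj.
Qed.

Lemma germ_pullback_monoid : monoid_morphism germ_pullback.
Proof.
split.
  rewrite -(rmorph1 \pi_(germ (Phi x))) germ_pullbackE -(rmorph1 \pi_(germ x)).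
  by congr (\pi_(germ x) _); exact: val_inj.
elim/quotW => f; elim/quotW => g.
rewrite -rmorphM !germ_pullbackE -rmorphM.
by congr (\pi_(germ x) _); exact: val_inj.
Qed.

HB.instance Definition _ :=
  GRing.isZmodMorphism.Build _ _ germ_pullback germ_pullback_zmod.
HB.instance Definition _ :=
  GRing.isMonoidMorphism.Build _ _ germ_pullback germ_pullback_monoid.

End Pullback.

Definition flat_map (V W : normedModType C) (X : charted V) (Y : charted W)
    (Phi : X -> Y) (hol_Phi : holomorphic Phi) :=
  forall x : X, flat_rmorphism (germ_pullback hol_Phi (x := x)).

Section Embeddings.
Variables (V W : normedModType C) (X : charted V) (Y : charted W).

Definition immersion_on (U : set X) (j : X -> Y) :=
  forall x, U x -> forall c c', atlas c -> atlas c' -> dom c x ->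
    dom c' (j x) -> injective ('d (fwd c' \o j \o bwd c) (fwd c x) : V -> W).

(* Injective holomorphic immersions U -> B that are closed maps, U and B being
   open in X and Y; closed subsets of U and B are traces of closed sets. *)
Record closed_embedding (U : set X) (B : set Y) (j : X -> Y) : Prop :=
  ClosedEmbedding {
    ce_fun : set_fun U B j;
    ce_holomorphic : holomorphic_on U j;
    ce_inj : set_inj U j;
    ce_immersion : immersion_on U j;
    ce_closed : forall F, closed F ->
      exists2 G, closed G & j @` (F `&` U) = G `&` B }.

(* g is a section over O of the ideal sheaf generated by f_0, ..., f_(l-1). *)
Definition in_ideal_sheaf (l : nat) (f : 'I_l -> Y -> C) (O : set Y)
    (g : Y -> C) :=
  forall p, O p -> exists (O' : set Y) (a : 'I_l -> Y -> C),
    [/\ open O', O' p, O' `<=` O, forall i, holomorphic_fun O' (a i) &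
        forall q, O' q -> g q = \sum_(i < l) a i q * f i q].

(* j : U -> B induces an isomorphism O_B / (f_0, ..., f_(l-1)) ~ j_* O_U, i.e.
   j^* : O_B -> j_* O_U is an epimorphism of sheaves (every section of j_* O_U
   is locally in the image) with kernel the ideal sheaf (f_0, ..., f_(l-1)). *)
Definition pullback_iso (U : set X) (B : set Y) (j : X -> Y) (l : nat)
    (f : 'I_l -> Y -> C) :=
  (forall (O : set Y) (g : Y -> C), open O -> O `<=` B -> holomorphic_fun O g ->
     (forall x, U x -> O (j x) -> g (j x) = 0) <-> in_ideal_sheaf f O g) /\
  (forall (O : set Y) (h : X -> C), open O -> O `<=` B ->
     holomorphic_fun (U `&` j @^-1` O) h ->
     forall p, O p -> exists (O' : set Y) (g : Y -> C),
       [/\ open O', O' p, O' `<=` O, holomorphic_fun O' g &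
           forall x, U x -> O' (j x) -> h x = g (j x)]).

Definition complete_intersection (U : set X) (B : set Y) (j : X -> Y)
    (l : nat) :=
  exists f : 'I_l -> Y -> C,
    (forall i, holomorphic_fun B (f i)) /\ pullback_iso U B j f.

End Embeddings.

Definition polycylinder (m : nat) (a : 'rV[C]_m) (r : R) : set 'rV[C]_m :=
  [set x | forall i, `|x 0 i - a 0 i| < r%:C%C].

Section RelativeCharts.
Variables (dZ dS : nat) (Z : complex_manifold dZ) (S : complex_manifold dS).
Variable Phi : Z -> S.

Definition affine_times (m : nat) := prodc (euclid 'rV[C]_m) S.

(* [rc_map] is only meaningful on [rc_dom]. *)
Record rel_chart (m : nat) := RelChart {
  rc_dom : set Z;
  rc_center : 'rV[C]_m;
  rc_radius : R;
  rc_base : set S;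
  rc_map : Z -> affine_times m;
  rc_dom_open : open rc_dom;
  rc_radius_gt0 : 0 < rc_radius;
  rc_base_open : open rc_base;
  rc_dom_base : forall z, rc_dom z -> rc_base (Phi z);
  rc_embedding : closed_embedding (Y := affine_times m) rc_dom
    (polycylinder rc_center rc_radius `*` rc_base) rc_map;
  rc_proj : forall z, rc_dom z -> (rc_map z).2 = Phi z }.

Definition rc_poly (m : nat) (j : rel_chart m) : set 'rV[C]_m :=
  polycylinder (rc_center j) (rc_radius j).

(* The intersection of the nonempty family j_0, ..., j_p; the product of the
   polycylinders sits in the affine space of dimension m_0 + ... + m_p. *)
Section Intersection.
Variables (p : nat) (m : 'I_p.+1 -> nat) (j : forall k, rel_chart (m k)).

Definition inter_dom : set Z := \bigcap_k rc_dom (j k).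

Definition inter_base : set S := \bigcap_k rc_base (j k).

Definition inter_poly : set 'rV[C]_(\sum_k m k) :=
  [set x | forall k, rc_poly (j k) (submxrow x k)].

Definition inter_map (z : Z) : affine_times (\sum_k m k) :=
  (\mxrow_k (rc_map (j k) z).1, Phi z).

(* l = sum_k m_k - n with n = dZ - dS, without truncated subtraction of l. *)
Definition inter_complete_intersection :=
  exists2 l : nat, (l + (dZ - dS) = \sum_k m k)%N &
    complete_intersection (Y := affine_times (\sum_k m k))
      inter_dom (inter_poly `*` inter_base) inter_map l.

End Intersection.
End RelativeCharts.
End Charts.

Arguments euclid {R} V.

(* Main.v *)
From HB Require Import structures.
Require Import Defs.
From mathcomp Require Import all_boot all_order all_algebra.
From mathcomp Require Import all_classical all_reals all_analysis.
From mathcomp Require Import ring lra.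

Set Implicit Arguments.
Unset Strict Implicit.
Unset Printing Implicit Defensive.

Import Order.TTheory GRing.Theory Num.Theory numFieldNormedType.Exports.

Local Open Scope classical_set_scope.
Local Open Scope ring_scope.

(** Around z, take a chart c_z of Z and a chart d_z of S around Phi(z), and let
    j_z be the graph map x |-> (c_z(x), Phi(x)) from the preimage of a small
    polycylinder about c_z(z) to the product of this polycylinder with the
    domain of d_z. This is a closed embedding ([graph_embedding]), and its first
    component is a bijection onto the polycylinder by construction.

    The image of an intersection of the charts at z_0, ..., z_p consists of the
    ((x_k), s) such that the points c_k^-1(x_k) of Z coincide and s is their
    image under Phi. If a single chart w of Z is defined on all the domains
    involved, this is expressed by the equations
      w(c_k^-1(x_k)) = w(c_0^-1(x_0)) for k = 1, ..., p,  and
      d_0(s) = d_0(Phi(c_0^-1(x_0))),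
    which are p dim Z + dim S in number and holomorphic on the whole product;
    this is the required codimension (p + 1) dim Z - (dim Z - dim S). The radii
    are chosen so that such a w exists: since Z is paracompact, every z has a
    neighbourhood N(z) such that those N(z) that contain a given point lie in
    the domain of one chart ([star_neighbourhoods]). When the intersection is
    empty, the equations 1 = 0 do.

    That the equations generate the ideal of the image is a local statement, and
    they can be taken as part of a system of coordinates. Solving them with a
    right-hand side u yields a holomorphic T(y, u), where T(y, f(y)) = y and
    T(y, 0) is in the image. If g vanishes on the image then g(T(y, u)) vanishes
    for u = 0, so that it is a combination of the coordinates of u by Hadamard's
    lemma ([hadamard]), and u = f(y) shows that g is in the ideal generated by
    the components of f ([complete_intersection_criterion]).

    Hadamard's lemma reduces to dividing a holomorphic function F by a linear
    form lam on whose kernel F vanishes ([holomorphic_division]). Holomorphic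
    only means complex differentiable at every point of an open set, so that the
    differentiability of F / lam at the zeros of lam rests on Cauchy's theory.
    The part of it that is used is one estimate ([second_order_estimate]): for k
    of modulus at most M on the square [-1, 1]^2, continuous, and differentiable
    but for one point other than 0, |k(w) - k(0) - k'(0) w| <= 32 M |w|^2 when
    |w| <= 1/2. It follows from Goursat's theorem, applied to difference
    quotients of k. No integral is involved: Riemann sums over the boundary of a
    square are additive under subdivision and vanish on affine functions, which
    is enough for the bisection argument ([goursat]). On the lines through
    points q outside the kernel, the quotient F / lam has at most one
    exceptional point, and the estimates, being uniform, persist when q tends to
    a point of the kernel ([differentiable_limit]). *)

(** * Real-valued norms *)

Section RealNorm.
Variable R : realType.
Local Notation C := (Cx R).
Implicit Types V W : normedModType C.

(** The norm of a complex normed module takes its values in the complex numbers,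
    which are only partially ordered; estimates are made with its real part,
    which determines it. *)
Definition nm V (v : V) : R := complex.Re (`|v| : R[i]).

Lemma nmE V (v : V) : `|v| = ((nm v)%:C)%C :> C.
Proof.
have h : (0 : R[i]) <= (`|v| : C) by exact: normr_ge0.
by rewrite /nm RRe_real //; apply: ger0_real.
Qed.

Lemma nm_ge0 V (v : V) : 0 <= nm v.
Proof. by have := normr_ge0 v; rewrite nmE lecR. Qed.

Lemma nm_eq0 V (v : V) : (nm v == 0) = (v == 0).
Proof.
rewrite -(normr_eq0 v) nmE; apply/eqP/eqP => [->|h]; first by [].
by case: h.
Qed.

Lemma nm0 V : nm (0 : V) = 0.
Proof. by apply/eqP; rewrite nm_eq0. Qed.

Lemma nm_gt0 V (v : V) : (0 < nm v) = (v != 0).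
Proof. by rewrite lt_neqAle nm_ge0 andbT eq_sym nm_eq0. Qed.

Lemma nmD V (u v : V) : nm (u + v) <= nm u + nm v.
Proof.
by have := ler_normD u v; rewrite !nmE -rmorphD lecR.
Qed.

Lemma nmN V (v : V) : nm (- v) = nm v.
Proof. by rewrite /nm normrN. Qed.

Lemma nmBC V (u v : V) : nm (u - v) = nm (v - u).
Proof. by rewrite -nmN opprB. Qed.

Lemma nmB V (u v : V) : nm (u - v) <= nm u + nm v.
Proof. by rewrite -(nmN v) nmD. Qed.

Lemma nm_le_dist V (u v : V) : nm u <= nm v + nm (u - v).
Proof. by rewrite -{1}(subrK v u) addrC nmD. Qed.

Lemma nm_tri V (u v w : V) : nm (u - w) <= nm (u - v) + nm (v - w).
Proof. by have := nmD (u - v) (v - w); rewrite addrA subrK. Qed.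

Lemma nmZ V (a : C) (v : V) : nm (a *: v) = nm a * nm v.
Proof.
have := normrZ a v; rewrite !nmE -rmorphM.
by move/(@complexI R).
Qed.

Lemma nmM (a b : C) : nm (a * b) = nm a * nm b.
Proof.
have := normrM a b; rewrite !nmE -rmorphM.
by move/(@complexI R).
Qed.

Lemma nm1 : nm (1 : C) = 1.
Proof. by rewrite /nm normr1. Qed.

Lemma nmV (a : C) : nm a^-1 = (nm a)^-1.
Proof.
have := normfV a; rewrite !nmE -fmorphV.
by move/(@complexI R).
Qed.

Lemma nmX (a : C) n : nm (a ^+ n) = nm a ^+ n.
Proof. by elim: n => [|n IH]; rewrite ?nm1 // !exprS nmM IH. Qed.

Lemma nm_real (r : R) : nm (r%:C%C : C) = `|r|.
Proof.
have -> : (nm (r%:C%C : C)) = ComplexField.Normc.normc (r%:C%C) by [].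
by rewrite /= expr0n /= addr0 sqrtr_sqr.
Qed.

Lemma nm_i : nm ('i%C : C) = 1.
Proof.
have -> : (nm ('i%C : C)) = ComplexField.Normc.normc ('i%C : R[i]) by [].
by rewrite /= expr0n /= add0r expr1n sqrtr1.
Qed.

Lemma Re_le_nm (z : C) : `|complex.Re z| <= nm z.
Proof.
by have := normc_ge_Re (z : R[i]); rewrite (nmE (z : C)) lecR.
Qed.

Lemma Im_le_nm (z : C) : `|complex.Im z| <= nm z.
Proof.
have := Re_le_nm ('i%C * z); rewrite nmM nm_i mul1r.
by case: z => x y; simpc => /=; rewrite normrN.
Qed.

Lemma complex_ReIm (z : C) :
  z = ((complex.Re z)%:C + 'i * (complex.Im z)%:C)%C.
Proof. by case: z => x y; simpc. Qed.

Lemma nm_le_ReIm (z : C) : nm z <= `|complex.Re z| + `|complex.Im z|.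
Proof.
rewrite {1}(complex_ReIm z); apply: le_trans (nmD _ _) _.
by rewrite nmM nm_i mul1r !nm_real.
Qed.

Lemma near_nmP V (x : V) (P : set V) :
  (\forall y \near x, P y) <->
  exists2 d : R, 0 < d & forall y, nm (y - x) < d -> P y.
Proof.
split.
  move=> /nbhs_normP[e /= e0 H].
  have er : e = ((complex.Re (e : R[i]))%:C)%C :> C.
    by rewrite RRe_real //; apply: gtr0_real.
  exists (complex.Re (e : R[i])); first by rewrite -ltcR -er.
  move=> y yd; apply: H; rewrite /ball_ /= distrC nmE er ltcR //.
move=> [d d0 H]; apply/nbhs_normP; exists (d%:C%C : C) => /=.
  by rewrite ltcR.
by move=> y /=; rewrite /ball_ /= distrC nmE ltcR; exact: H.
Qed.

Lemma continuous_nmP V W (f : V -> W) (x : V) :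
  {for x, continuous f} <->
  forall e : R, 0 < e ->
    exists2 d : R, 0 < d & forall y, nm (y - x) < d -> nm (f y - f x) < e.
Proof.
split.
  move=> fc e e0; apply/near_nmP.
  have : \forall v \near f x, nm (v - f x) < e by apply/near_nmP; exists e.
  exact: fc.
move=> H P /near_nmP[e e0 eP]; apply/near_nmP.
by have [d d0 dP] := H e e0; exists d => // y /dP /eP.
Qed.

Lemma differentiable_nm V W (f : V -> W) (x : V) : differentiable f x ->
  forall e : R, 0 < e -> exists2 d : R, 0 < d &
    forall y, nm (y - x) < d ->
      nm (f y - f x - 'd f x (y - x)) <= e * nm (y - x).
Proof.
move=> df e e0; have /eqaddoP H := diff_locally df.
have {}H := H (e%:C%C) _.
have /H/near_nmP[d d0 dP] : 0 < (e%:C%C : C) by rewrite ltcR.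
exists d => // y yd; have := dP (y - x); rewrite subr0 => /(_ yd).
by rewrite !fctE /= subrK !nmE -rmorphM lecR opprD addrA.
Qed.

Lemma nm_differentiable V W (f : V -> W) (L : {linear V -> W}) (x : V) :
  continuous L ->
  (forall e : R, 0 < e -> exists2 d : R, 0 < d &
    forall y, nm (y - x) < d ->
      nm (f y - f x - L (y - x)) <= e * nm (y - x)) ->
  differentiable f x.
Proof.
move=> Lc H; apply: (differentiable_intro Lc); apply/eqaddoP => e e0.
have er : e = ((complex.Re (e : R[i]))%:C)%C :> C.
  by rewrite RRe_real //; apply: gtr0_real.
have /H[d d0 dP] : 0 < complex.Re (e : R[i]) by rewrite -ltcR -er.
apply/near_nmP; exists d => // y; rewrite subr0 => yd.
have := dP (y + x); rewrite addrK => /(_ yd).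
by rewrite !fctE /= !nmE er -rmorphM lecR opprD addrA.
Qed.

End RealNorm.

(** * Riemann sums along segments and boundaries of squares *)

Section SegmentSums.
Variable R : realType.
Local Notation C := (Cx R).
Implicit Types (h g : C -> C) (a v : C) (n : nat).

Definition rC (t : R) : C := (t%:C)%C.
Definition iC : C := ('i%C : R[i]).

Lemma rCD (s t : R) : rC (s + t) = rC s + rC t.
Proof. by rewrite /rC rmorphD. Qed.

Lemma rCM (s t : R) : rC (s * t) = rC s * rC t.
Proof. by rewrite /rC rmorphM. Qed.

Lemma rCN (s : R) : rC (- s) = - rC s.
Proof. by rewrite /rC rmorphN. Qed.

Lemma rC1 : rC 1 = 1. Proof. by []. Qed.

Lemma rC0 : rC 0 = 0. Proof. by []. Qed.

Lemma rC_half : rC 2^-1 = 2^-1.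
Proof. by rewrite /rC fmorphV rmorph_nat. Qed.

Lemma iC2 : iC * iC = -1.
Proof. by have := @sqr_i R; rewrite expr2. Qed.

Lemma rC_iC (z : C) :
  z = rC (complex.Re (z : R[i])) + iC * rC (complex.Im (z : R[i])).
Proof. exact: complex_ReIm. Qed.

Lemma pairC (x y : R) : rC x + iC * rC y = ((x +i* y)%C : R[i]).
Proof. by rewrite /rC /iC; simpc. Qed.

(** The left Riemann sum with 2^n terms of the integral of h(z) dz along the
    segment from a to a + v. Cutting the segment in its middle, rather than
    listing the points of subdivision, makes the sums additive under bisection
    by definition, so that no integral is needed. *)
Fixpoint msum n h a v : C :=
  if n is n'.+1 then msum n' h a (v / 2) + msum n' h (a + v / 2) (v / 2)
  else h a * v.

Lemma seg_left (t : R) a v : a + rC t * (v / 2) = a + rC (t / 2) * v.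
Proof. by rewrite rCM rC_half; ring. Qed.

Lemma seg_right (t : R) a v :
  a + v / 2 + rC t * (v / 2) = a + rC ((t + 1) / 2) * v.
Proof. by rewrite rCM rC_half rCD rC1; ring. Qed.

Lemma eq_msum n h g a v :
  (forall t, 0 <= t <= 1 -> h (a + rC t * v) = g (a + rC t * v)) ->
  msum n h a v = msum n g a v.
Proof.
elim: n a v => [|n IH] a v H /=.
  by have := H 0; rewrite rC0 mul0r addr0 => ->//; rewrite lexx ler01.
congr (_ + _); apply: IH => t t01; rewrite ?seg_right ?seg_left; apply: H; lra.
Qed.

Lemma msum_lin n h g c a v :
  msum n (fun z => h z + c * g z) a v = msum n h a v + c * msum n g a v.
Proof. by elim: n a v => [|n IH] a v /=; rewrite ?IH; ring. Qed.

Lemma msumN n h a v : msum n (fun z => - h z) a v = - msum n h a v.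
Proof. by elim: n a v => [|n IH] a v /=; rewrite ?IH; ring. Qed.

Lemma nm_half v : nm (v / 2) = nm v / 2.
Proof. by rewrite nmM -rC_half nm_real ger0_norm //; lra. Qed.

Lemma msum_bound n h a v (M : R) :
  (forall t, 0 <= t <= 1 -> nm (h (a + rC t * v)) <= M) ->
  nm (msum n h a v) <= M * nm v.
Proof.
elim: n a v => [|n IH] a v H /=.
  rewrite nmM ler_wpM2r ?nm_ge0 //.
  by have := H 0; rewrite rC0 mul0r addr0; apply; rewrite lexx ler01.
apply: le_trans (nmD _ _) _.
have -> : M * nm v = M * nm (v / 2) + M * nm (v / 2) by rewrite nm_half; field.
by apply: lerD; apply: IH => t t01; rewrite ?seg_right ?seg_left; apply: H; lra.
Qed.

Lemma msum_Im_ge n h a v (m : R) :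
  (forall t, 0 <= t <= 1 -> m <= complex.Im (h (a + rC t * v) * v : R[i])) ->
  m <= complex.Im (msum n h a v : R[i]).
Proof.
elim: n a v m => [|n IH] a v m H /=.
  by have := H 0; rewrite rC0 mul0r addr0; apply; rewrite lexx ler01.
have half z : complex.Im (z * (v / 2) : R[i]) = complex.Im (z * v : R[i]) / 2.
  rewrite mulrA -rC_half /rC; case: (z * v) => p q; simpc => /=; ring.
rewrite (raddfD (@complex.Im R : R[i] -> R)) /= [m](_ : _ = m / 2 + m / 2);
  last by field.
apply: lerD; apply: IH => t t01; rewrite ?seg_right ?seg_left half ler_pM2r //;
  apply: H; lra.
Qed.

(* The defect k * be * v ^+ 2 of the left Riemann sum of an affine function
   depends on v through its square only, and so cancels between opposite edges
   of a square. *)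
Lemma msum_affine n : exists k : C, forall (al be : C) a v,
  msum n (fun z => al + be * z) a v = (al + be * a) * v + k * be * v ^+ 2.
Proof.
elim: n => [|n [k IH]]; first by exists 0 => *; rewrite /= !mul0r addr0.
by exists (k / 2 + 1 / 4) => al be a v /=; rewrite !IH; field.
Qed.

(** The Riemann sums of the integral of h(z) dz along the boundary, oriented
    counterclockwise, of the square with side s and lower left corner a. *)
Definition bsum n h a (s : R) : C :=
  msum n h a (rC s) + msum n h (a + rC s) (iC * rC s)
  - msum n h (a + iC * rC s) (rC s) - msum n h a (iC * rC s).

(** The contributions of the inner edges cancel, exactly and not only in the
    limit. *)
Lemma bsum_split n h a s :
  bsum n.+1 h a s = bsum n h a (s / 2) + bsum n h (a + rC (s / 2)) (s / 2)
    + bsum n h (a + iC * rC (s / 2)) (s / 2)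
    + bsum n h (a + rC (s / 2) + iC * rC (s / 2)) (s / 2).
Proof.
rewrite /bsum /= !rCM !rC_half.
have -> : a + rC s / 2 + rC s / 2 = a + rC s by field.
have -> : a + iC * (rC s / 2) + iC * (rC s / 2) = a + iC * rC s by field.
have -> : a + rC s + iC * rC s / 2 = a + rC s + iC * (rC s / 2) by ring.
have -> : a + iC * rC s / 2 = a + iC * (rC s / 2) by ring.
have -> : a + iC * (rC s / 2) + rC s / 2 = a + rC s / 2 + iC * (rC s / 2)
  by ring.
have -> : a + iC * rC s + rC s / 2 = a + rC s / 2 + iC * rC s by ring.
have -> : a + rC s / 2 + iC * (rC s / 2) + rC s / 2 = a + rC s + iC * (rC s /
  2) by field.
have -> : a + rC s / 2 + iC * (rC s / 2) + iC * (rC s / 2) = a + rC s / 2 + iC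
  * rC s by field.
have -> : iC * rC s / 2 = iC * (rC s / 2) by ring.
ring.
Qed.

Definition square a (s : R) : set C := [set z |
  exists p q : R, [/\ 0 <= p <= s, 0 <= q <= s & z = a + rC p + iC * rC q]].

Definition sq_boundary a (s : R) : set C := [set z |
  exists p q : R, [/\ 0 <= p <= s, 0 <= q <= s, z = a + rC p + iC * rC q &
    [|| p == 0, p == s, q == 0 | q == s]]].

Section Edges.
Variables (a : C) (s : R) (s_ge0 : 0 <= s).

Lemma scale01 t : 0 <= t <= 1 -> 0 <= t * s <= s.
Proof. by move=> /andP[t0 t1]; rewrite mulr_ge0 //= ler_piMl. Qed.

Let s_ss : (0 : R) <= 0 <= s.
Proof. by rewrite lexx. Qed.

Let s_s : 0 <= s <= s.
Proof. by rewrite lexx andbT. Qed.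

Lemma edge_bottom t : 0 <= t <= 1 -> sq_boundary a s (a + rC t * rC s).
Proof.
move=> t01; exists (t * s), 0; split => //; first exact: scale01.
- by rewrite rCM rC0; ring.
- by rewrite eqxx !orbT.
Qed.

Lemma edge_top t : 0 <= t <= 1 ->
  sq_boundary a s (a + iC * rC s + rC t * rC s).
Proof.
move=> t01; exists (t * s), s; split => //; first exact: scale01.
- by rewrite rCM; ring.
- by rewrite eqxx !orbT.
Qed.

Lemma edge_left t : 0 <= t <= 1 -> sq_boundary a s (a + rC t * (iC * rC s)).
Proof.
move=> t01; exists 0, (t * s); split => //; first exact: scale01.
- by rewrite rCM rC0; ring.
- by rewrite eqxx.
Qed.

Lemma edge_right t : 0 <= t <= 1 ->
  sq_boundary a s (a + rC s + rC t * (iC * rC s)).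
Proof.
move=> t01; exists s, (t * s); split => //; first exact: scale01.
- by rewrite rCM; ring.
- by rewrite eqxx !orbT.
Qed.

Lemma eq_bsum n h g : (forall z, sq_boundary a s z -> h z = g z) ->
  bsum n h a s = bsum n g a s.
Proof.
move=> H; rewrite /bsum.
congr (_ + _ - _ - _); apply: eq_msum => t t01; apply: H.
- exact: edge_bottom.
- exact: edge_right.
- exact: edge_top.
- exact: edge_left.
Qed.

Lemma bsum_bound n h (M : R) : (forall z, sq_boundary a s z -> nm (h z) <= M) ->
  nm (bsum n h a s) <= 4 * M * s.
Proof.
move=> H; rewrite /bsum.
have nr : nm (rC s) = s by rewrite nm_real ger0_norm.
have ni : nm (iC * rC s) = s by rewrite nmM nm_i mul1r.
have -> : 4 * M * s = M * nm (rC s) + M * nm (iC * rC s) + M * nm (rC s)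
    + M * nm (iC * rC s) by rewrite nr ni; ring.
apply: le_trans (nmB _ _) _; apply: lerD; last first.
  by apply: msum_bound => t t01; apply: H; exact: edge_left.
apply: le_trans (nmB _ _) _; apply: lerD; last first.
  by apply: msum_bound => t t01; apply: H; exact: edge_top.
apply: le_trans (nmD _ _) _; apply: lerD; last first.
  by apply: msum_bound => t t01; apply: H; exact: edge_right.
by apply: msum_bound => t t01; apply: H; exact: edge_bottom.
Qed.

Lemma sq_boundary_sub : sq_boundary a s `<=` square a s.
Proof. by move=> z [p [q [*]]]; exists p, q. Qed.

End Edges.

Lemma bsum_lin n h g c a s :
  bsum n (fun z => h z + c * g z) a s = bsum n h a s + c * bsum n g a s.
Proof. by rewrite /bsum !msum_lin; ring. Qed.

(** Riemann sums already vanish on affine functions, whence the sums of a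
    differentiable function over a square of side s are o(s^2). *)
Lemma bsum_affine n (al be : C) a s : bsum n (fun z => al + be * z) a s = 0.
Proof.
have [k K] := msum_affine n; rewrite /bsum !K !exprMn.
have -> : iC ^+ 2 = -1 by rewrite expr2 iC2.
have -> : (al + be * (a + rC s)) * (iC * rC s) =
  (al + be * a) * (iC * rC s) + iC * be * rC s ^+ 2 by ring.
have -> : (al + be * (a + iC * rC s)) * rC s =
  (al + be * a) * rC s + iC * be * rC s ^+ 2 by ring.
ring.
Qed.

End SegmentSums.

(** * Goursat's theorem by bisection *)

Section Bisection.
Variable R : realType.
Local Notation C := (Cx R).

Lemma nested_intervals (u v : nat -> R) :
  (forall k, u k <= u k.+1) -> (forall k, v k.+1 <= v k) ->
  (forall k, u k <= v k) -> exists x, forall k, u k <= x <= v k.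
Proof.
move=> uu vv uv.
have mu : {homo u : m n / (m <= n)%N >-> m <= n}.
  by apply: homo_leq => // y x z; exact: le_trans.
have mv : {homo v : m n / (m <= n)%N >-> n <= m}.
  apply: (homo_leq (r := fun x y => y <= x)) => // y x z xy yz.
  exact: le_trans yz xy.
have uv' j k : u j <= v k.
  apply: le_trans (mu _ _ (leq_maxl j k)) _.
  by apply: le_trans (uv _) _; apply: mv; exact: leq_maxr.
exists (sup (range u)) => k; apply/andP; split.
  apply: ub_le_sup; last by exists k.
  by exists (v 0%N) => _ [j _ <-].
apply: ge_sup; first by exists (u 0%N), 0%N.
by move=> _ [j _ <-].
Qed.

Lemma small_dyadic (s d : R) : 0 < s -> 0 < d -> exists k, s / 2 ^+ k < d.
Proof.
move=> s0 d0; have [k sdk] : exists k : nat, s / d < k%:R.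
  by exists (Num.bound (s / d)); apply: archi_boundP; rewrite divr_ge0 // ltW.
exists k; rewrite ltr_pdivrMr ?exprn_gt0 // mulrC -ltr_pdivrMr //.
apply: lt_le_trans sdk _; rewrite -natrX ler_nat.
by apply: ltnW; exact: ltn_expl.
Qed.

(** Otherwise one of the four quarters fails as well; the nested squares
    obtained by iterating shrink to a point, near which the property holds. *)
Lemma square_bisection (P : C -> R -> Prop) (a : C) (s : R) : 0 < s ->
  (forall b u, 0 < u -> P b (u / 2) -> P (b + rC (u / 2)) (u / 2) ->
     P (b + iC R * rC (u / 2)) (u / 2) ->
     P (b + rC (u / 2) + iC R * rC (u / 2)) (u / 2) -> P b u) ->
  (forall z, square a s z -> exists2 d, 0 < d &
     forall b u, 0 < u -> u < d -> square b u z -> P b u) ->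
  P a s.
Proof.
move=> s0 quarters loc; apply: contrapT => nP.
pose corner (c : R * R) := a + rC c.1 + iC R * rC c.2.
have step (x : R * (R * R)) : exists c : R * R, 0 < x.1 ->
  ~ P (corner x.2) x.1 ->
    [/\ ~ P (corner c) (x.1 / 2), x.2.1 <= c.1, x.2.2 <= c.2,
        c.1 + x.1 / 2 <= x.2.1 + x.1 & c.2 + x.1 / 2 <= x.2.2 + x.1].
  case: x => u [p q] /=; have [u0|_] := ltP 0 u; last by exists (0, 0).
  have [Pb|nPb] := pselect (P (corner (p, q)) u); first by exists (0, 0).
  have [P1|P1] := pselect (P (corner (p, q)) (u / 2)); last first.
    by exists (p, q) => /= _ _; split=> //; lra.
  have [P2|P2] := pselect (P (corner (p + u / 2, q)) (u / 2)); last first.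
    by exists (p + u / 2, q) => /= _ _; split=> //; lra.
  have [P3|P3] := pselect (P (corner (p, q + u / 2)) (u / 2)); last first.
    by exists (p, q + u / 2) => /= _ _; split=> //; lra.
  have [P4|P4] := pselect (P (corner (p + u / 2, q + u / 2)) (u / 2));
    last first.
    by exists (p + u / 2, q + u / 2) => /= _ _; split=> //; lra.
  case: nPb; apply: quarters => //.
  - by move: P2; rewrite /corner /= rCD; congr (P _ _); ring.
  - by move: P3; rewrite /corner /= rCD; congr (P _ _); ring.
  - by move: P4; rewrite /corner /= !rCD; congr (P _ _); ring.
have [f fP] := choice step.
pose side k := s / 2 ^+ k.
have side0 k : 0 < side k by rewrite divr_gt0 // exprn_gt0.
have sideS k : side k.+1 = side k / 2 by rewrite /side exprS invfM; ring.
pose c := fix c k := if k is k'.+1 then f (side k', c k') else (0, 0).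
have nPc k : ~ P (corner (c k)) (side k).
  elim: k => [|k IH]; last first.
    by have [] := fP (side k, c k) (side0 k) IH; rewrite /= sideS.
  by rewrite /side expr0 divr1 /corner /= !rC0 mulr0 !addr0.
have cP k := fP (side k, c k) (side0 k) (nPc k).
have [||k|p pP] := @nested_intervals (fun k => (c k).1) (fun k =>
  (c k).1 + side k).
- by move=> k; have [] := cP k.
- by move=> k; rewrite sideS; have [] := cP k.
- by rewrite lerDl ltW.
have [||k|q qP] := @nested_intervals (fun k => (c k).2) (fun k =>
  (c k).2 + side k).
- by move=> k; have [] := cP k.
- by move=> k; rewrite sideS; have [] := cP k.
- by rewrite lerDl ltW.
have [|d d0 dP] := loc (a + rC p + iC R * rC q).
  exists p, q; split=> //; [have := pP 0%N|have := qP 0%N];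
    by rewrite /= add0r /side expr0 divr1.
have [k kd] := small_dyadic s0 d0.
apply: (nPc k); apply: dP => //.
exists (p - (c k).1), (q - (c k).2); split.
- by have := pP k; lra.
- by have := qP k; lra.
- by rewrite /corner !rCD !rCN; ring.
Qed.

End Bisection.

Section Goursat.
Variable R : realType.
Local Notation C := (Cx R).
Implicit Types (h : C -> C) (a z : C) (s : R).

Definition eps_continuous h z := forall e : R, 0 < e ->
  exists2 d : R, 0 < d & forall y, nm (y - z) < d -> nm (h y - h z) < e.

Definition eps_derivative h z (l : C) := forall e : R, 0 < e ->
  exists2 d : R, 0 < d & forall y, nm (y - z) < d ->
    nm (h y - h z - l * (y - z)) <= e * nm (y - z).

(** The error allowed for the boundary sums over a square: its area, plus at
    least its side when it contains an exceptional point. Weighting the side by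
    the jump of the sign of Re z - Re e makes the second term additive under
    division into quarters, like the area. *)
Definition budget (E : seq C) a s : R := s ^+ 2 + s * \sum_(e <- E)
  (Num.sg (complex.Re (a : R[i]) + s - complex.Re (e : R[i]))
   - Num.sg (complex.Re (a : R[i]) - complex.Re (e : R[i]))).

Lemma Re_add_rC a (t : R) :
  complex.Re (a + rC t : R[i]) = complex.Re (a : R[i]) + t.
Proof. by case: a. Qed.

Lemma Re_add_irC a (t : R) :
  complex.Re (a + iC R * rC t : R[i]) = complex.Re (a : R[i]).
Proof. by case: a => p q; rewrite /rC /iC; simpc. Qed.

Lemma budget_split E a s :
  budget E a s = budget E a (s / 2) + budget E (a + rC (s / 2)) (s / 2)
    + budget E (a + iC R * rC (s / 2)) (s / 2)
    + budget E (a + rC (s / 2) + iC R * rC (s / 2)) (s / 2).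
Proof.
rewrite /budget !Re_add_irC !Re_add_rC.
set A := complex.Re (a : R[i]).
have -> : A + s / 2 + s / 2 = A + s by field.
have -> : \sum_(e <- E) (Num.sg (A + s - complex.Re (e : R[i]))
    - Num.sg (A - complex.Re (e : R[i]))) =
  \sum_(e <- E) (Num.sg (A + s / 2 - complex.Re (e : R[i]))
    - Num.sg (A - complex.Re (e : R[i]))) +
  \sum_(e <- E) (Num.sg (A + s - complex.Re (e : R[i]))
    - Num.sg (A + s / 2 - complex.Re (e : R[i]))).
  by rewrite -big_split; apply: eq_bigr => e _ /=; ring.
set X := \sum_(_ <- _) _; set Y := \sum_(_ <- _) _; by field.
Qed.

Lemma budget_sum_ge0 (E : seq C) a s : 0 <= s ->
  0 <= \sum_(e <- E) (Num.sg (complex.Re (a : R[i]) + s - complex.Re (e : R[i]))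
   - Num.sg (complex.Re (a : R[i]) - complex.Re (e : R[i]))).
Proof.
move=> s0; apply: sumr_ge0 => e _; rewrite subr_ge0.
set A := complex.Re (a : R[i]); set B := complex.Re (e : R[i]).
by case: (sgrP (A - B)); case: (sgrP (A + s - B)); lra.
Qed.

Lemma budget_ge_area E a s : 0 <= s -> s ^+ 2 <= budget E a s.
Proof. by move=> s0; rewrite lerDl mulr_ge0 // budget_sum_ge0. Qed.

Lemma budget_ge_side (E : seq C) a s e : e \in E -> 0 < s -> square a s e ->
  s <= budget E a s.
Proof.
move=> eE s0 [p [q [p01 q01 ee]]].
have Ree : complex.Re (e : R[i]) = complex.Re (a : R[i]) + p.
  by rewrite ee Re_add_irC Re_add_rC.
rewrite /budget (big_rem e) //=.
have := budget_sum_ge0 (rem e E) a (ltW s0).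
set X := \sum_(_ <- _) _ => X0; rewrite Ree; set A := complex.Re _.
have : 1 <= Num.sg (A + s - (A + p)) - Num.sg (A - (A + p)).
  by case: (sgrP (A - (A + p))); case: (sgrP (A + s - (A + p))); lra.
set Y := Num.sg _ - _ => Y1.
have : s * 1 <= s * (Y + X) by rewrite ler_pM2l //; lra.
by have := sqr_ge0 s; lra.
Qed.

Lemma square_diam a s y z : square a s y -> square a s z -> nm (y - z) <= 2 * s.
Proof.
move=> [p [q [p01 q01 ->]]] [p' [q' [p01' q01' ->]]].
have -> : a + rC p + iC R * rC q - (a + rC p' + iC R * rC q') =
  rC (p - p') + iC R * rC (q - q') by rewrite !rCD !rCN; ring.
apply: le_trans (nmD _ _) _; rewrite nmM nm_i mul1r !nm_real.
have : `|p - p'| <= s by rewrite ler_norml; lra.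
have : `|q - q'| <= s by rewrite ler_norml; lra.
by lra.
Qed.

(** Near a point where h is differentiable, the boundary sums are at most a
    small multiple of the area of the square, since affine functions contribute
    nothing; near an exceptional point, continuity bounds them by a small
    multiple of the side. Both are within the budget, and the estimate passes
    from the quarters of a square to the square. *)
Lemma goursat h (E : seq C) a s : 0 < s ->
  (forall z, square a s z -> eps_continuous h z) ->
  (forall z, square a s z -> z \notin E -> exists l, eps_derivative h z l) ->
  forall e : R, 0 < e -> exists N, forall n, (N <= n)%N ->
    nm (bsum n h a s) < e.
Proof.
move=> s0 hc hd e e0.
pose P e b u := exists N, forall n, (N <= n)%N ->
  nm (bsum n h b u) <= e * budget E b u.
suff [N NP] : P (e / (budget E a s + 1)) a s.
  exists N => n /NP /le_lt_trans; apply.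
  have := budget_ge_area E a (ltW s0); have := sqr_ge0 s => s2 sb.
  rewrite mulrAC -mulrA gtr_pMr // ltr_pdivrMr; lra.
have : 0 < e / (budget E a s + 1).
  have := budget_ge_area E a (ltW s0); have := sqr_ge0 s => s2 sb.
  by rewrite divr_gt0 //; lra.
move: (e / _) => {e0}e e0; apply: square_bisection => //.
  move=> b u u0 [N1 H1] [N2 H2] [N3 H3] [N4 H4].
  exists (maxn (maxn N1 N2) (maxn N3 N4)).+1 => -[//|n].
  rewrite ltnS !geq_max => /andP[/andP[/H1 {}H1 /H2 {}H2] /andP[/H3 {}H3 /H4
    {}H4]].
  rewrite bsum_split budget_split 3!mulrDr.
  by apply: le_trans (nmD _ _) _; apply: (lerD _ H4);
    apply: le_trans (nmD _ _) _;
    apply: (lerD _ H3); apply: le_trans (nmD _ _) _; apply: lerD.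
move=> z az; have [zE|zE] := boolP (z \in E).
  have e4 : 0 < e / 4 by rewrite divr_gt0.
  have [d d0 dP] := hc z az _ e4.
  exists (d / 2); first by rewrite divr_gt0.
  move=> b u u0 ud bz; exists 0%N => n _.
  have -> : bsum n h b u = bsum n (fun y => (h y - h z)) b u.
    transitivity (bsum n (fun y => (fun y =>
      (h y - h z)) y + h z * (fun=> 1) y) b u).
      by apply: eq_bsum => [|y _]; [exact: ltW|rewrite mulr1 subrK].
    rewrite bsum_lin [X in _ + _ * X](_ : _ = 0) ?mulr0 ?addr0 //.
    transitivity (bsum n (fun y => 1 + 0 * y) b u); last exact: bsum_affine.
    by apply: eq_bsum => [|y _]; [exact: ltW|rewrite mul0r addr0].
  apply: le_trans (@bsum_bound _ _ _ (ltW u0) _ _ (e / 4) _) _.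
    move=> y /sq_boundary_sub by_; apply: ltW; apply: dP.
    by apply: le_lt_trans (square_diam by_ bz) _; lra.
  have -> : 4 * (e / 4) * u = e * u by field.
  by rewrite ler_pM2l //; exact: (budget_ge_side zE u0 bz).
have [l hl] := hd z az zE.
have e8 : 0 < e / 8 by rewrite divr_gt0.
have [d d0 dP] := hl _ e8.
exists (d / 2); first by rewrite divr_gt0.
move=> b u u0 ud bz; exists 0%N => n _.
have -> : bsum n h b u = bsum n (fun y => (h y - h z - l * (y - z))) b u.
  transitivity (bsum n (fun y => (fun y => (h y - h z - l * (y - z))) y
    + 1 * (fun y => (h z - l * z) + l * y) y) b u).
    by apply: eq_bsum => [|y _]; [exact: ltW|ring].
  by rewrite bsum_lin bsum_affine mulr0 addr0.
apply: le_trans (@bsum_bound _ _ _ (ltW u0) _ _ (e / 8 * (2 * u)) _) _.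
  move=> y /sq_boundary_sub by_; have diam := square_diam by_ bz.
  apply: le_trans (dP _ _) _; first by lra.
  by rewrite ler_pM2l.
have -> : 4 * (e / 8 * (2 * u)) * u = e * u ^+ 2 by field.
by rewrite ler_pM2l //; apply: budget_ge_area; exact: ltW.
Qed.

End Goursat.

(** * Difference quotients on a square *)

Lemma near_eq_continuous (X Y : topologicalType) (f g : X -> Y) (x : X) :
  (\forall y \near x, f y = g y) ->
  {for x, continuous f} -> {for x, continuous g}.
Proof.
move=> fg fc P; rewrite -(nbhs_singleton fg) => /fc.
by apply: filterS2 fg => y; rewrite /= => ->.
Qed.

Lemma differentiable_id (K : numFieldType) (V : normedModType K) (x : V) :
  differentiable (fun y : V => y) x.
Proof. by apply: (@linear_differentiable _ _ _ idfun) => ?; exact: cvg_id. Qed.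

Section DifferenceQuotients.
Variable R : realType.
Local Notation C := (Cx R).

Lemma differentiable_eps_derivative (h : C -> C) (z : C) :
  differentiable h z -> exists l, eps_derivative h z l.
Proof.
move=> dh; exists ('d h z 1) => e e0.
have [d d0 dP] := differentiable_nm dh e0; exists d => // y /dP.
have -> : 'd h z (y - z) = 'd h z 1 * (y - z).
  transitivity ('d h z ((y - z) *: (1 : C))); last by rewrite linearZ mulrC.
  by congr ('d h z _); rewrite /GRing.scale /= mulr1.
by [].
Qed.

Lemma near_neq (w z : C) : z != w -> \forall y \near z, y != w.
Proof.
move=> zw; apply/near_nmP; exists (nm (z - w)).
  by rewrite nm_gt0 subr_eq0.
move=> y yz; apply: contraTneq yz => ->.
by rewrite nmBC ltxx.
Qed.

Definition quotient (k : C -> C) (w l : C) : C -> C :=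
  fun z => if z == w then l else (k z - k w) / (z - w).

Lemma near_quotient (k : C -> C) (w l z : C) : z != w ->
  \forall y \near z, (k y - k w) * (y - w)^-1 = quotient k w l y.
Proof.
by move=> /near_neq; apply: filterS => y yw; rewrite /quotient (negbTE yw).
Qed.

Lemma quotient_continuous (k : C -> C) (w l z : C) : eps_derivative k w l ->
  {for z, continuous k} -> {for z, continuous (quotient k w l)}.
Proof.
move=> kl kc; have [->|zw] := eqVneq z w.
  apply/continuous_nmP => e e0.
  have [d d0 dP] := kl (e / 2) (divr_gt0 e0 (ltr0Sn _ 1)).
  exists d => // y yd; rewrite /quotient eqxx; case: (eqVneq y w) => yw.
    by rewrite subrr nm0.
  have yw0 : y - w != 0 by rewrite subr_eq0.
  have := dP y yd.
  have -> : k y - k w - l * (y - w) = ((k y - k w) / (y - w) - l) * (y - w).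
    by rewrite mulrBl divfK.
  rewrite nmM ler_pM2r ?nm_gt0 // => H; apply: le_lt_trans H _.
  by rewrite ltr_pdivrMr //; lra.
have H : {for z, continuous (fun y => (k y - k w) * (y - w)^-1)}.
  have tr (g : C -> C) c : {for z, continuous g} ->
      {for z, continuous (fun y => g y - c)}.
    move=> /continuous_nmP gc; apply/continuous_nmP => e /gc[d d0 dP].
    by exists d => // y; rewrite opprB addrA subrK; exact: dP.
  have Hn := tr k (k w) kc.
  have Hd : {for z, continuous (fun y : C => y - w)}.
    by apply: (tr id w); exact: cvg_id.
  have zw0 : z - w != 0 by rewrite subr_eq0.
  have Hi := @continuousV C C (fun y : C => y - w) z zw0 Hd.
  exact: (@continuousM C C (fun y => k y - k w) (fun y => (y - w)^-1) z Hn Hi).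
exact: near_eq_continuous (near_quotient k l zw) H.
Qed.

Lemma quotient_differentiable (k : C -> C) (w l z : C) : z != w ->
  differentiable k z -> differentiable (quotient k w l) z.
Proof.
move=> zw dk; apply: near_eq_differentiable (near_quotient k l zw) _.
apply: (@differentiableM _ _ (fun y => k y - k w) (fun y => (y - w)^-1)).
  by apply: differentiableB => //; exact: differentiable_cst.
apply: (@differentiableV _ _ (fun y => y - w)); last by rewrite subr_eq0.
by apply: differentiableB; [exact: differentiable_id|exact: differentiable_cst].
Qed.

(* The square is [-1, 1]^2. *)
Definition unit_sw : C := - 1 - iC R.

Definition unit_square : set C := square unit_sw 2.

Lemma unit_squareP (z : C) : nm z <= 1 -> unit_square z.
Proof.
move=> z1; exists (complex.Re (z : R[i]) + 1), (complex.Im (z : R[i]) + 1).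
have := le_trans (Re_le_nm z) z1; have := le_trans (Im_le_nm z) z1.
rewrite !ler_norml => H1 H2; split; [lra|lra|].
rewrite {1}(rC_iC z) !rCD rC1 /unit_sw; ring.
Qed.

Lemma unit_square_nm (z : C) : unit_square z -> nm z <= 2.
Proof.
move=> [p [q [p01 q01 ->]]].
have -> : unit_sw + rC p + iC R * rC q = rC (p - 1) + iC R * rC (q - 1).
  by rewrite !rCD !rCN rC1 /unit_sw; ring.
apply: le_trans (nmD _ _) _; rewrite nmM nm_i mul1r !nm_real.
have : `|p - 1| <= 1 by rewrite ler_norml; lra.
have : `|q - 1| <= 1 by rewrite ler_norml; lra.
by lra.
Qed.

Lemma unit_boundary_nm (z : C) : sq_boundary unit_sw 2 z -> 1 <= nm z.
Proof.
move=> [p [q [p01 q01 -> pq]]].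
have -> : unit_sw + rC p + iC R * rC q = rC (p - 1) + iC R * rC (q - 1).
  by rewrite !rCD !rCN rC1 /unit_sw; ring.
have H1 := Re_le_nm (rC (p - 1) + iC R * rC (q - 1)).
have H2 := Im_le_nm (rC (p - 1) + iC R * rC (q - 1)).
rewrite pairC /= in H1 H2; rewrite pairC.
have lb (t : R) x : (t == 0) || (t == 2) -> `|t - 1| <= x -> 1 <= x.
  by case/orP => /eqP->; apply: le_trans;
    rewrite ?sub0r ?normrN1 // ler_normr; lra.
case/or4P: pq => H; [apply: lb H1|apply: lb H1|apply: lb H2|apply: lb H2];
  by rewrite H ?orbT.
Qed.

Lemma Im_div (x y u v : R) : 0 < x ^+ 2 + y ^+ 2 ->
  complex.Im ((rC x + iC R * rC y)^-1 * (rC u + iC R * rC v) : R[i]) =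
  (x * v - y * u) / (x ^+ 2 + y ^+ 2).
Proof.
move=> n0; rewrite !pairC.
have -> : ((x +i* y)%C : C)^-1 = (x / (x ^+ 2 + y ^+ 2) -i* (y / (x ^+ 2 + y
  ^+ 2)))%C by [].
by simpc => /=; field; rewrite gt_eqF.
Qed.

(** The boundary sums of 1/z stay away from 0: along each of the four edges Im
    (dz / z) = |dz| / (1 + t^2) is at least |dz| / 2. *)
Lemma bsum_inv_lower n : 4 <= nm (bsum n (fun z => z^-1) unit_sw 2).
Proof.
apply: le_trans (Im_le_nm _); rewrite ler_normr; apply/orP; left.
have edge (x y u v : R) (z w : C) : z = rC x + iC R * rC y ->
    w = rC u + iC R * rC v -> x * v - y * u = 2 -> 0 < x ^+ 2 + y ^+ 2 ->
    x ^+ 2 + y ^+ 2 <= 2 -> 1 <= complex.Im (z^-1 * w : R[i]).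
  move=> -> -> H n0 n2; rewrite Im_div // H ler_pdivlMr // mul1r //.
have ImD (y z : C) : complex.Im (y + z : R[i]) =
  complex.Im (y : R[i]) + complex.Im (z : R[i]) by case: y; case: z.
rewrite /bsum -!msumN !ImD.
have -> : 4 = 1 + 1 + 1 + 1 :> R by ring.
have r2 : rC 2 = 1 + 1 :> C by rewrite rCD rC1.
apply: lerD; [apply: lerD; [apply: lerD|]|];
  apply: msum_Im_ge => t /andP[t0 t1];
  have r2t : rC (2 * t - 1) = (1 + 1) * rC t - 1 :> C by rewrite rCD rCM r2 rCN.
- apply: (@edge (2 * t - 1) (-1) 2 0); rewrite ?rC0 ?mulr0 ?addr0 //;
    last 3 first.
  + by ring.
  + by nra.
  + by nra.
  by rewrite /unit_sw r2t ?rCN rC1 r2; ring.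
- apply: (@edge 1 (2 * t - 1) 0 2); rewrite ?rC0 ?mulr0 ?add0r //; last 3 first.
  + by ring.
  + by nra.
  + by nra.
  by rewrite /unit_sw r2t ?rCN rC1 r2; ring.
- rewrite mulNr -mulrN.
  apply: (@edge (2 * t - 1) 1 (-2) 0); rewrite ?rC0 ?mulr0 ?addr0 //;
    last 3 first.
  + by ring.
  + by nra.
  + by nra.
  + by rewrite /unit_sw r2t ?rCN rC1 r2; ring.
  + by rewrite rCN.
- rewrite mulNr -mulrN.
  apply: (@edge (-1) (2 * t - 1) 0 (-2)); rewrite ?rC0 ?mulr0 ?add0r //;
    last 3 first.
  + by ring.
  + by nra.
  + by nra.
  + by rewrite /unit_sw r2t ?rCN rC1 r2; ring.
  + by rewrite rCN mulrN.
Qed.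

End DifferenceQuotients.

(** * Second-order estimates for holomorphic functions of one variable *)

Section SecondOrder.
Variable R : realType.
Local Notation C := (Cx R).
Local Notation Q := (@unit_square R).
Local Notation J := (fun n h => bsum n h (unit_sw R) 2).

Variables (k : C -> C) (e : C) (M : R).
Hypotheses (e_neq0 : e != 0) (k_cont : forall z, Q z -> {for z, continuous k})
  (k_diff : forall z, Q z -> z != e -> differentiable k z)
  (k_bound : forall z, Q z -> nm (k z) <= M).

Let M_ge0 : 0 <= M.
Proof.
apply: le_trans (nm_ge0 (k 0)) (k_bound (unit_squareP _)).
by rewrite nm0 ler01.
Qed.

(** The difference quotient at w is continuous on the square and differentiable
    outside w and the exceptional point e, so that Goursat's theorem applies. *)
Lemma goursat_quotient (w : C) : nm w <= 2^-1 -> w != e ->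
  forall r : R, 0 < r ->
  exists N, forall n, (N <= n)%N ->
    nm (J n (fun z => (k z - k w) / (z - w))) < r.
Proof.
move=> w2 we r r0; have w1 : nm w <= 1 by lra.
have [l kl] := differentiable_eps_derivative (k_diff (unit_squareP w1) we).
have s0 : 0 < 2 :> R by [].
have [||N NP] := @goursat R (quotient k w l) [:: e;
  w] (unit_sw R) 2 s0 _ _ r r0.
- by move=> z Qz; apply/continuous_nmP; apply: quotient_continuous kl _;
    exact: k_cont.
- move=> z Qz; rewrite !inE negb_or => /andP[ze zw].
  by apply: differentiable_eps_derivative;
    apply: quotient_differentiable => //; exact: k_diff.
exists N => n /NP; rewrite (@eq_bsum _ _ _ _ _ _ (fun z =>
  (k z - k w) / (z - w))) //.
move=> z /unit_boundary_nm z1; rewrite /quotient ifN //.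
by apply: contraTneq z1 => ->; rewrite -ltNge; lra.
Qed.

(** This is Cauchy's formula in disguise. For small w, the boundary sums of the
    difference quotients of k at w and at 0 both tend to 0. On the boundary,
    1/(z - w) = 1/z + w/z^2 + w^2/(z^2 (z - w)); hence, J denoting the boundary
    sums, their difference reads
      (k(w) - k(0)) J(1/z) = w J((k(z) - k(0))/z^2) + O(M |w|^2) + o(1),
    where J(1/z) stays away from 0. The slopes are the quotients J((k(z) -
    k(0))/z^2) / J(1/z), which do not depend on w. *)
Lemma second_order_slopes : exists b : nat -> C, forall w : C, nm w <= 2^-1 ->
  w != e ->
  forall r : R, 0 < r -> exists N, forall n, (N <= n)%N ->
    nm (k w - k 0 - b n * w) <= 32 * M * nm w ^+ 2 + r.
Proof.
exists (fun n => J n (fun z => (k z - k 0) / z ^+ 2) / J n (fun z => z^-1)) =>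
  w w2 we r r0.
have r4 : 0 < r / 4 by rewrite divr_gt0.
have [N1 NP1] := goursat_quotient w2 we r4.
have e0 : 0 != e by rewrite eq_sym.
have n0 : nm (0 : C) <= 2^-1 by rewrite nm0 invr_ge0.
have [N2 NP2] := goursat_quotient n0 e0 r4.
exists (maxn N1 N2) => n; rewrite geq_max => /andP[/NP1 {}NP1 /NP2 {}NP2].
set c0 := J n (fun z => z^-1); set B := J n (fun z => (k z - k 0) / z ^+ 2).
pose c1 := J n (fun z => (z ^+ 2)^-1).
pose D := J n (fun z => (k z - k w) / (z ^+ 2 * (z - w))).
set del := k w - k 0.
have far z : sq_boundary (unit_sw R) 2 z -> [/\ 1 <= nm z, 2^-1 <= nm (z - w),
    z != 0, z - w != 0 & nm (k z) <= M].
  move=> bz; have z1 := unit_boundary_nm bz.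
  have zw : 2^-1 <= nm (z - w) by have := nm_le_dist z w; lra.
  split=> //; [by rewrite -nm_gt0; lra|by rewrite -nm_gt0; lra|].
  by apply: k_bound; exact: sq_boundary_sub.
have s0 : 0 <= 2 :> R by [].
have kw : nm (k w) <= M by apply: k_bound; apply: unit_squareP; lra.
have k0 : nm (k 0) <= M by apply: k_bound; apply: unit_squareP; rewrite nm0.
have split_J : J n (fun z => (k z - k w) / (z - w)) =
  J n (fun z => (k z - k 0) / (z - 0)) + w * B - w * del * c1 + w ^+ 2 * D -
    del * c0.
  rewrite -[- (w * del * c1)]mulNr -[- (del * c0)]mulNr -!bsum_lin.
  apply: eq_bsum => // z /far[_ _ z0 zw _]; rewrite subr0 /del; field.
  by rewrite zw z0.
set A1 := J n (fun z => (k z - k w) / (z - w)) in NP1 split_J.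
set A2 := J n (fun z => (k z - k 0) / (z - 0)) in NP2 split_J.
have inv_le1 (z : C) : 1 <= nm z -> nm z^-1 <= 1.
  by move=> z1; rewrite nmV invf_le1 //; lra.
have inv2_le1 (z : C) : 1 <= nm z -> nm (z ^+ 2)^-1 <= 1.
  by move=> z1; apply: inv_le1; rewrite nmX expr_ge1 //; lra.
have B_le : nm B <= 16 * M.
  have -> : 16 * M = 4 * (2 * M) * 2 by ring.
  apply: bsum_bound => // z /far[z1 _ _ _ kz]; rewrite nmM.
  have := inv2_le1 z z1; have := nmB (k z) (k 0); have := nm_ge0 (k z - k 0).
  have := nm_ge0 (z ^+ 2)^-1; nra.
have c1_le : nm c1 <= 8.
  have -> : 8 = 4 * 1 * 2 :> R by ring.
  by apply: bsum_bound => // z /far[z1 _ _ _ _]; exact: inv2_le1.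
have D_le : nm D <= 32 * M.
  have -> : 32 * M = 4 * (4 * M) * 2 by ring.
  apply: bsum_bound => // z /far[z1 zw2 z0 zw kz].
  rewrite invfM mulrA !nmM.
  have i2 := inv2_le1 z z1; have kk := nmB (k z) (k w);
    have kk0 := nm_ge0 (k z - k w).
  have i20 := nm_ge0 (z ^+ 2)^-1.
  have iw : nm (z - w)^-1 <= 2.
    by rewrite nmV -[leRHS]invrK lef_pV2 ?posrE ?invr_gt0 ?nm_gt0.
  have iw0 := nm_ge0 (z - w)^-1.
  have H1 : nm (k z - k w) * nm (z ^+ 2)^-1 <= 2 * M by nra.
  have H10 : 0 <= nm (k z - k w) * nm (z ^+ 2)^-1 by rewrite mulr_ge0.
  by nra.
have c0_ge : 4 <= nm c0 by exact: bsum_inv_lower.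
have c00 : c0 != 0 by rewrite -nm_gt0; lra.
have del_le2 : nm del <= 2 * M by have := nmB (k w) (k 0); rewrite -/del; lra.
have w0 := nm_ge0 w; have del0 := nm_ge0 del.
have E1 : del * c0 = w * B - w * del * c1 + w ^+ 2 * D + (A2 - A1).
  by rewrite split_J; ring.
have A_le : nm (A2 - A1) <= r / 2 by have := nmB A2 A1; lra.
have wD : nm (w ^+ 2 * D) <= 32 * M * nm w ^+ 2.
  by rewrite nmM nmX mulrC ler_wpM2r // exprn_ge0.
have wdc : nm (w * del * c1) <= 8 * (nm w * nm del).
  by rewrite !nmM mulrC ler_wpM2r // mulr_ge0.
(* A first estimate of k w - k 0, linear in w, makes the term w * del * c1
   quadratic. *)
have del_le : nm del <= 12 * M * nm w + r / 8.
  have : nm (del * c0) <= 16 * M * nm w + 16 * M * nm w + 16 * M * nm w + r / 2.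
    rewrite E1; apply: le_trans (nmD _ _) _; apply: lerD => //.
    apply: le_trans (nmD _ _) _; apply: lerD; last first.
      apply: le_trans wD _; have := ler_wpM2l (mulr_ge0 M_ge0 w0) w2.
      by rewrite expr2; lra.
    apply: le_trans (nmB _ _) _; apply: lerD; last first.
      apply: le_trans wdc _.
      have : nm w * nm del <= nm w * (2 * M) by rewrite ler_wpM2l.
      by lra.
    by rewrite nmM mulrC ler_wpM2r.
  rewrite nmM => H; have : nm del * 4 <= nm del * nm c0 by rewrite ler_wpM2l.
  by lra.
have -> : del - B / c0 * w = (del * c0 - w * B) / c0 by field.
rewrite nmM nmV ler_pdivrMr ?nm_gt0 //.
have -> : del * c0 - w * B = - (w * del * c1) + w ^+ 2 * D + (A2 - A1).
  by rewrite E1; ring.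
apply: le_trans (nmD _ _) _; apply: le_trans (lerD (nmD _ _) A_le) _.
rewrite nmN.
have H1 : nm w * nm del <= 12 * M * nm w ^+ 2 + r / 16.
  have : nm w * nm del <= nm w * (12 * M * nm w + r / 8) by rewrite ler_wpM2l.
  have : nm w * (r / 8) <= 2^-1 * (r / 8) by rewrite ler_wpM2r //; lra.
  by rewrite mulrDr expr2; lra.
have H2 : 0 <= 32 * M * nm w ^+ 2 + r.
  by rewrite addr_ge0 ?mulr_ge0 ?exprn_ge0 // ltW.
have : (32 * M * nm w ^+ 2 + r) * 4 <= (32 * M * nm w ^+ 2 + r) * nm c0.
  by rewrite ler_wpM2l.
lra.
Qed.

(** The exceptional point makes the estimate apply to a quotient whose
    denominator vanishes once on the square. The bound depends on k through M
    only, so that it is uniform over all lines through a point. *)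
Lemma second_order_estimate (d w : C) : eps_derivative k 0 d -> nm w <= 2^-1 ->
  nm (k w - k 0 - d * w) <= 32 * M * nm w ^+ 2.
Proof.
move=> kd w2; have [b bP] := second_order_slopes.
(* Comparing the estimate with the derivative at a very small point rC t shows
   that the slopes converge to the derivative. *)
have slope r : 0 < r -> exists N, forall n, (N <= n)%N -> nm (b n - d) <= r.
  move=> r0.
  have r3 : 0 < r / 3 by rewrite divr_gt0.
  have [dl dl0 dlP] := kd _ r3.
  have e0 : 0 < nm e by rewrite nm_gt0.
  pose K := 32 * M + 1; have K0 : 0 < K by rewrite ltr_wpDl // mulr_ge0.
  pose t := Num.min (Num.min (dl / 2) (nm e / 2)) (Num.min (r / 3 / K) 2^-1).
  have t0 : 0 < t.
    have rK : 0 < r / 3 / K by rewrite divr_gt0.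
    by rewrite !lt_min rK invr_gt0 ltr0Sn !divr_gt0.
  have [tdl te tr t2] : [/\ t <= dl / 2, t <= nm e / 2,
    t <= r / 3 / K & t <= 2^-1].
    by split; rewrite !ge_min lexx ?orbT.
  have nt : nm (rC t) = t by rewrite nm_real gtr0_norm.
  have tnz : rC t != 0 by rewrite -nm_gt0 nt.
  have [|||N NP] := bP (rC t) _ _ (r / 3 * t).
  - by rewrite nt.
  - by apply: contraTneq te => <-; rewrite nt -ltNge; lra.
  - by rewrite mulr_gt0.
  exists N => n /NP; rewrite nt => H1.
  have := dlP (rC t); rewrite subr0 nt => H2.
  have {}H2 := H2 ltac:(lra).
  have : nm ((b n - d) * rC t) <= r * t.
    have -> : (b n - d) * rC t = (k (rC t) - k 0 - d * rC t)
      - (k (rC t) - k 0 - b n * rC t) by ring.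
    apply: le_trans (nmB _ _) _.
    have H3 : 32 * M * t ^+ 2 <= r / 3 * t.
      rewrite expr2 mulrA ler_pM2r //.
      move: tr; rewrite ler_pdivlMr // /K; nra.
    lra.
  by rewrite nmM nt ler_pM2r.
have main (u : C) : nm u <= 2^-1 -> u != e ->
  nm (k u - k 0 - d * u) <= 32 * M * nm u ^+ 2.
  move=> u2 ue; apply/ler_addgt0Pr => r r0.
  have r2 : 0 < r / 2 by rewrite divr_gt0.
  have [N1 NP1] := bP u u2 ue _ r2; have [N2 NP2] := slope _ r2.
  have := NP1 _ (leq_maxl N1 N2); have := NP2 _ (leq_maxr N1 N2).
  set n := maxn N1 N2 => H2 H1.
  have -> : k u - k 0 - d * u = (k u - k 0 - b n * u) + (b n - d) * u by ring.
  apply: le_trans (nmD _ _) _; rewrite nmM.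
  have := nm_ge0 u; have := nm_ge0 (b n - d); nra.
have [we|] := eqVneq w e; last exact: main.
(* At the exceptional point the estimate follows by continuity, from points u
   approaching e along the radius. *)
apply/ler_addgt0Pr => r r0.
pose K := 1 + nm d; have K0 : 0 < K by rewrite ltr_wpDr ?nm_ge0.
have rK : 0 < r / K by rewrite divr_gt0.
have Qe : Q e by apply: unit_squareP; rewrite -we; lra.
have /continuous_nmP kc := k_cont Qe; have [dl dl0 dlP] := kc _ rK.
have e0 : 0 < nm e by rewrite nm_gt0.
pose t := Num.min (Num.min (dl / 2) (nm e)) (r / K) / nm e.
have t0 : 0 < t by rewrite divr_gt0 // !lt_min e0 !divr_gt0.
have [tdl te tr] : [/\ t * nm e <= dl / 2,
  t * nm e <= nm e & t * nm e <= r / K].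
  by rewrite /t divfK ?gt_eqF //; split; rewrite !ge_min lexx ?orbT.
have t1 : t <= 1 by rewrite -(ler_pM2r e0) mul1r.
pose u := (1 - rC t) * e.
have nu : nm u = (1 - t) * nm e.
  by rewrite nmM -rC1 -rCN -rCD nm_real ger0_norm //; lra.
have ue : nm (u - e) = t * nm e.
  have -> : u - e = - rC t * e by rewrite /u; ring.
  by rewrite nmM nmN nm_real gtr0_norm.
have H1 : nm (k u - k 0 - d * u) <= 32 * M * nm u ^+ 2.
  have e2 : nm e <= 2^-1 by rewrite -we.
  have te0 : 0 <= t * nm e by rewrite mulr_ge0 // ltW.
  apply: main; first by rewrite nu mulrBl mul1r; lra.
  by rewrite -subr_eq0 -nm_gt0 ue mulr_gt0.
have H2 : nm (k u - k e) < r / K by apply: dlP; rewrite ue; lra.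
rewrite we; have -> : k e - k 0 - d * e = (k u - k 0 - d * u) - (k u - k e)
  + d * (u - e) by ring.
apply: le_trans (nmD _ _) _; apply: le_trans (lerD (nmB _ _) (lexx _)) _.
rewrite nmM ue.
have H3 : nm u ^+ 2 <= nm e ^+ 2.
  by apply: lerXn2r; rewrite ?nnegrE ?nm_ge0 // nu; nra.
have H4 : 32 * M * nm u ^+ 2 <= 32 * M * nm e ^+ 2.
  by rewrite ler_wpM2l // mulr_ge0.
have H5 : nm d * (t * nm e) <= nm d * (r / K) by rewrite ler_wpM2l ?nm_ge0.
have H6 : r / K + nm d * (r / K) = r by rewrite /K; field; rewrite gt_eqF.
lra.
Qed.

End SecondOrder.

(** * Limits of complex differentials *)

Section Completeness.
Variable R : realType.
Local Notation C := (Cx R).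

Lemma real_cauchy (u : nat -> R) :
  (forall e, 0 < e -> exists N, forall m n, (N <= m)%N -> (N <= n)%N ->
     `|u m - u n| <= e) ->
  exists l, forall e, 0 < e -> exists N, forall n, (N <= n)%N ->
    `|u n - l| <= e.
Proof.
move=> uc; have cu : cvgn u.
  apply: cauchy_cvg; apply/cauchy_ballP => e e0.
  have [N NP] := uc (e / 2) (divr_gt0 e0 (ltr0Sn _ 1)).
  near_simpl; exists ([set n | (N <= n)%N], [set n | (N <= n)%N]) => /=.
    by split; exists N.
  move=> [m n] /= [Nm Nn]; apply: le_lt_trans (NP _ _ Nm Nn) _; lra.
exists (limn u) => e e0.
have /cvgrPdist_le /(_ e e0) [N _ NP] := cu.
by exists N => n Nn; rewrite distrC; exact: NP.
Qed.

Lemma complex_cauchy (u : nat -> C) :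
  (forall e : R, 0 < e -> exists N, forall m n, (N <= m)%N -> (N <= n)%N ->
     nm (u m - u n) <= e) ->
  exists l, forall e : R, 0 < e -> exists N, forall n, (N <= n)%N ->
    nm (u n - l) <= e.
Proof.
move=> uc.
have ReB (x y : C) : complex.Re (x - y : R[i]) = complex.Re (x : R[i]) -
  complex.Re (y : R[i]).
  by case: x; case: y.
have ImB (x y : C) : complex.Im (x - y : R[i]) = complex.Im (x : R[i]) -
  complex.Im (y : R[i]).
  by case: x; case: y.
have [|x xP] := @real_cauchy (fun n => complex.Re (u n : R[i])).
  move=> e /uc[N NP]; exists N => m n Nm Nn; rewrite -ReB.
  exact: le_trans (Re_le_nm _) (NP _ _ Nm Nn).
have [|y yP] := @real_cauchy (fun n => complex.Im (u n : R[i])).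
  move=> e /uc[N NP]; exists N => m n Nm Nn; rewrite -ImB.
  exact: le_trans (Im_le_nm _) (NP _ _ Nm Nn).
exists ((x +i* y)%C : R[i]) => e e0; have e2 : 0 < e / 2 by rewrite divr_gt0.
have [N1 NP1] := xP _ e2; have [N2 NP2] := yP _ e2.
exists (maxn N1 N2) => n; rewrite geq_max => /andP[/NP1 H1 /NP2 H2].
by apply: le_trans (nm_le_ReIm _) _; rewrite ReB ImB /=; lra.
Qed.

End Completeness.

Section LimitOfDifferentials.
Variables (R : realType) (V : normedModType (Cx R)).
Local Notation C := (Cx R).

Lemma linear_mul (L : {linear V -> C}) (c : C) (v : V) : L (c *: v) = c * L v.
Proof. by rewrite linearZ. Qed.

Lemma nm_diff_compare (x1 x0 y1 y0 z1 z0 dx dy : C) :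
  nm (dx - dy) <= nm (x1 - x0 - dx) + nm (y1 - y0 - dy) + nm (x1 - z1)
    + nm (x0 - z0) + nm (y1 - z1) + nm (y0 - z0).
Proof.
have -> : dx - dy = y1 - y0 - dy - (x1 - x0 - dx) + (x1 - z1) - (x0 - z0)
  - (y1 - z1) + (y0 - z0) by ring.
apply: le_trans (nmD _ _) _; rewrite lerD2r.
apply: le_trans (nmB _ _) _; rewrite lerD2r.
apply: le_trans (nmB _ _) _; rewrite lerD2r.
apply: le_trans (nmD _ _) _; rewrite lerD2r.
by apply: le_trans (nmB _ _) _; rewrite addrC.
Qed.

(** A uniform second-order estimate at points q n tending to v passes to the
    limit: it forces the differentials D n to form a pointwise Cauchy sequence,
    since D n h is, up to K |h|^2, an increment of the continuous function a,
    and rescaling h makes the error negligible. *)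
Lemma differentiable_limit (a : V -> C) (v : V) (q : nat -> V)
    (D : nat -> {linear V -> C}) (r K : R) : 0 < r -> 0 <= K ->
  (forall e : R, 0 < e -> exists N, forall n, (N <= n)%N -> nm (q n - v) < e) ->
  (forall h, nm h < r -> {for v + h, continuous a}) ->
  (forall n h, nm h < r -> nm (a (q n + h) - a (q n) - D n h) <= K * nm h ^+
    2) ->
  differentiable a v.
Proof.
move=> r0 K0 qv ac est.
have a_q h : nm h < r -> forall e : R, 0 < e ->
    exists N, forall n, (N <= n)%N -> nm (a (q n + h) - a (v + h)) < e.
  move=> /ac /continuous_nmP H e /H[d d0 dP]; have [N NP] := qv d d0.
  exists N => n /NP Hn; apply: dP.
  by rewrite opprD addrACA subrr addr0.
have v0 : nm (0 : V) < r by rewrite nm0.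
have small (h : V) : exists2 s : R, 0 < s & forall s', 0 < s' -> s' <= s ->
  nm (rC s' *: h) < r.
  exists (r / (nm h + 1)) => [|s' s'0 s's].
    by rewrite divr_gt0 // ltr_wpDl ?nm_ge0.
  have h1 : 0 < nm h + 1 by rewrite ltr_wpDl ?nm_ge0.
  rewrite nmZ nm_real gtr0_norm //; move: s's; rewrite ler_pdivlMr //;
    have := nm_ge0 h; nra.
have lim_h (h : V) : exists l, forall e : R, 0 < e ->
    exists N, forall n, (N <= n)%N -> nm (D n h - l) <= e.
  apply: complex_cauchy => e e0; have [s0 s00 s0P] := small h.
  pose B := 4 * K * nm h ^+ 2 + 1.
  have B0 : 0 < B by rewrite ltr_wpDl ?mulr_ge0 ?exprn_ge0 ?nm_ge0.
  pose s := Num.min s0 (e / B).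
  have s_gt0 : 0 < s by rewrite lt_min s00 divr_gt0.
  have sh : nm (rC s *: h) < r by apply: s0P => //; rewrite ge_min lexx.
  have sB : s * B <= e by rewrite -ler_pdivlMr // ge_min lexx orbT.
  have es : 0 < e * s / 8 by rewrite divr_gt0 ?mulr_gt0.
  have [N1 NP1] := a_q _ sh _ es; have [N2 NP2] := a_q _ v0 _ es.
  exists (maxn N1 N2) => m n; rewrite !geq_max.
  move=> /andP[/NP1 Hm1 /NP2 Hm2] /andP[/NP1 Hn1 /NP2 Hn2].
  rewrite !addr0 in Hm2 Hn2.
  have Em := est m _ sh; have En := est n _ sh.
  have := nm_diff_compare (a (q m + rC s *: h)) (a (q m)) (a (q n + rC s *: h))
    (a (q n)) (a (v + rC s *: h)) (a v) (D m (rC s *: h)) (D n (rC s *: h)).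
  have -> : D m (rC s *: h) - D n (rC s *: h) = rC s * (D m h - D n h).
    by rewrite !linear_mul mulrBr.
  rewrite nmM nm_real gtr0_norm // => H1.
  have nsh : nm (rC s *: h) ^+ 2 = s ^+ 2 * nm h ^+ 2.
    by rewrite nmZ nm_real gtr0_norm // exprMn.
  rewrite nsh in Em En.
  rewrite -(ler_pM2l s_gt0).
  have : s * (s * B) <= s * e by rewrite ler_pM2l.
  have -> : s * (s * B) = 4 * (K * (s ^+ 2 * nm h ^+ 2)) + s ^+ 2
    by rewrite /B; ring.
  have := sqr_ge0 s; lra.
have [L LP] := choice lim_h.
have uniq_lim (x y : C) : (forall e : R, 0 < e -> nm (x - y) <= e) -> x = y.
  move=> H; apply/eqP; rewrite -subr_eq0 -nm_eq0 eq_le nm_ge0 andbT.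
  by apply/ler_addgt0Pr => e /H; rewrite add0r.
have L_linear : linear L.
  move=> c x y; apply: uniq_lim => e e0.
  pose B := nm c + 2; have B0 : 0 < B by rewrite ltr_wpDl ?nm_ge0.
  have eB : 0 < e / B by rewrite divr_gt0.
  have [N1 NP1] := LP (c *: x + y) _ eB; have [N2 NP2] := LP x _ eB.
  have [N3 NP3] := LP y _ eB.
  set n := maxn N1 (maxn N2 N3).
  have H1 := NP1 n (leq_maxl _ _).
  have H2 : nm (D n x - L x) <= e / B by apply: NP2;
    rewrite /n !leq_max leqnn orbT.
  have H3 : nm (D n y - L y) <= e / B by apply: NP3;
    rewrite /n !leq_max leqnn !orbT.
  have -> : L (c *: x + y) - (c *: L x + L y) =
    c * (D n x - L x) + (D n y - L y) - (D n (c *: x + y) - L (c *: x + y)).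
    have -> : D n (c *: x + y) = c * D n x + D n y by exact: linearP.
    by change (c *: L x) with (c * L x); ring.
  apply: le_trans (nmB _ _) _; apply: le_trans (lerD (nmD _ _) (lexx _)) _.
  rewrite nmM.
  have H4 : nm c * nm (D n x - L x) <= nm c * (e / B)
    by rewrite ler_wpM2l ?nm_ge0.
  have -> : e = nm c * (e / B) + e / B + e / B by rewrite /B; field;
    rewrite gt_eqF.
  lra.
pose LM := GRing.isLinear.Build _ _ _ _ L L_linear.
pose LL : {linear V -> C} := HB.pack L LM.
have Lest h : nm h < r -> nm (a (v + h) - a v - L h) <= K * nm h ^+ 2.
  move=> hr; apply/ler_addgt0Pr => e e0.
  have e3 : 0 < e / 3 by rewrite divr_gt0.
  have [N1 NP1] := a_q _ hr _ e3; have [N2 NP2] := a_q _ v0 _ e3.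
  have [N3 NP3] := LP h _ e3.
  set n := maxn N1 (maxn N2 N3).
  have H1 := NP1 n (leq_maxl _ _).
  have H2 : nm (a (q n) - a v) < e / 3.
    by have := NP2 n; rewrite !addr0; apply; rewrite /n !leq_max leqnn orbT.
  have H3 : nm (D n h - L h) <= e / 3 by apply: NP3;
    rewrite /n !leq_max leqnn !orbT.
  have := est n h hr.
  have -> : a (v + h) - a v - L h = (a (q n + h) - a (q n) - D n h)
    - ((a (q n + h) - a (v + h)) - (a (q n) - a v) - (D n h - L h)) by ring.
  have := nmB (a (q n + h) - a (q n) - D n h)
    ((a (q n + h) - a (v + h)) - (a (q n) - a v) - (D n h - L h)).
  have := nmB ((a (q n + h) - a (v + h)) - (a (q n) - a v)) (D n h - L h).
  have := nmB (a (q n + h) - a (v + h)) (a (q n) - a v).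
  lra.
apply: (@nm_differentiable _ _ _ a LL).
  apply: (@continuousfor0_continuous _ _ _ LL); apply/continuous_nmP => e e0.
  have e2 : 0 < e / 2 by rewrite divr_gt0.
  have /continuous_nmP ac0 := ac 0 v0; have [d d0 dP] := ac0 _ e2.
  pose B := 2 * K + 1; have B0 : 0 < B by rewrite ltr_wpDl ?mulr_ge0.
  pose d' := Num.min (Num.min d r) (Num.min 1 (e / B)).
  exists d'; first by rewrite !lt_min d0 r0 ltr01 divr_gt0.
  move=> y; rewrite (linear0 LL) !subr0 !lt_min =>
    /andP[/andP[yd yr] /andP[y1 yB]].
  have H1 := Lest y yr.
  have H2 : nm (a (v + y) - a v) < e / 2.
    by rewrite -[X in a _ - a X]addr0; apply: dP;
      rewrite opprD addrACA subrr add0r subr0.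
  rewrite /=.
  have -> : L y = (a (v + y) - a v) - (a (v + y) - a v - L y) by ring.
  apply: le_lt_trans (nmB _ _) _.
  have y0 := nm_ge0 y.
  have H3 : K * nm y ^+ 2 <= K * nm y
    by rewrite ler_wpM2l // expr2 ler_piMl // ltW.
  move: yB; rewrite ltr_pdivlMr // /B; lra.
move=> e e0; pose B := K + 1; have B0 : 0 < B by rewrite ltr_wpDl.
exists (Num.min r (e / B)); first by rewrite lt_min r0 divr_gt0.
move=> y; rewrite lt_min => /andP[yr yB].
have := Lest (y - v) yr; rewrite [v + _]addrC subrK => H; apply: le_trans H _.
have y0 := nm_ge0 (y - v).
rewrite expr2 mulrA ler_wpM2r //.
move: yB; rewrite ltr_pdivlMr // /B; nra.
Qed.

Lemma line_continuous (q h : V) (t : C) :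
  {for t, continuous (fun s : C => q + s *: h)}.
Proof.
apply/continuous_nmP => e e0.
have h1 : 0 < nm h + 1 by rewrite ltr_wpDl ?nm_ge0.
exists (e / (nm h + 1)); first by rewrite divr_gt0.
move=> y; rewrite ltr_pdivlMr // => yt.
rewrite opprD addrACA subrr add0r -scalerBl nmZ.
by have := nm_ge0 (y - t); nra.
Qed.

Lemma line_differentiable (q h : V) (t : C) :
  differentiable (fun s : C => q + s *: h) t.
Proof.
apply: (@differentiableD _ _ _ (cst q)); first exact: differentiable_cst.
apply: (@differentiableZl _ _ _ (fun s : C => s)); exact: differentiable_id.
Qed.

(** The restriction of a to the complex line through q with direction h is a
    function of one variable, differentiable outside e; its parameter is scaled
    so that the square [-1, 1]^2 is mapped into the ball of radius r. *)
Lemma line_estimate (a : V -> C) (q h : V) (r M : R) (e : C) : 0 < r ->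
  (forall v, nm (v - q) < r -> {for v, continuous a}) ->
  (forall v, nm (v - q) < r -> nm (a v) <= M) ->
  e != 0 -> differentiable a q ->
  (forall t : C, nm (t *: h) < r -> t != e -> differentiable a (q + t *: h)) ->
  nm h <= r / 8 ->
  nm (a (q + h) - a q - 'd a q h) <= 512 * M / r ^+ 2 * nm h ^+ 2.
Proof.
move=> r0 ac aM e0 daq da hr.
have [->|h0] := eqVneq h 0.
  have d0 : 'd a q 0 = 0 by exact: linear0.
  by rewrite addr0 subrr d0 subr0 !nm0 expr0n mulr0.
have h_gt0 : 0 < nm h by rewrite nm_gt0.
pose c := r / (4 * nm h); have c0 : 0 < c by rewrite divr_gt0 ?mulr_gt0.
have cC0 : rC c != 0 by rewrite -nm_gt0 nm_real gtr0_norm.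
have nch : nm (rC c *: h) = r / 4.
  by rewrite nmZ nm_real gtr0_norm // /c; field; rewrite gt_eqF.
pose k (t : C) := a (q + t *: (rC c *: h)).
have in_ball t : unit_square t -> nm (q + t *: (rC c *: h) - q) < r.
  move=> /unit_square_nm t2; rewrite addrC addKr nmZ nch; nra.
have ec0 : e / rC c != 0 by rewrite mulf_neq0 // invr_eq0.
have := @second_order_estimate R k (e / rC c) M ec0 _ _ _ ('d a q (rC c *: h))
  (rC c^-1) _ _.
have -> : k (rC c^-1) = a (q + h).
  rewrite /k scalerA -rCM mulVf ?gt_eqF // rC1 scale1r //.
have -> : k 0 = a q by rewrite /k scale0r addr0.
have -> : 'd a q (rC c *: h) * rC c^-1 = 'd a q h.
  by rewrite linear_mul mulrAC -rCM divff ?gt_eqF // rC1 mul1r.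
have ncV : nm (rC c^-1 : C) = 4 * nm h / r.
  rewrite nm_real gtr0_norm ?invr_gt0 // /c; field.
  by rewrite !gt_eqF.
rewrite ncV.
have -> : 32 * M * (4 * nm h / r) ^+ 2 = 512 * M / r ^+ 2 * nm h ^+ 2.
  by field; rewrite gt_eqF.
apply.
- move=> t Qt; apply: (@continuous_comp _ _ _ (fun s : C =>
    q + s *: (rC c *: h)) a).
    exact: line_continuous.
  by apply: ac; exact: in_ball.
- move=> t Qt te; apply: (@differentiable_comp _ _ _ _ (fun s : C =>
    q + s *: (rC c *: h)) a).
    exact: line_differentiable.
  rewrite scalerA; apply: da.
    by have := in_ball t Qt; rewrite addrC addKr scalerA.
  by apply: contraNneq te => <-; rewrite mulfK.
- by move=> t /in_ball; exact: aM.
- move=> b b0.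
  have ch1 : 0 < r / 4 + 1 by rewrite ltr_wpDl // divr_ge0 // ltW.
  have [d d0 dP] := differentiable_nm daq (divr_gt0 b0 ch1).
  exists (d / (r / 4 + 1)); first by rewrite divr_gt0.
  move=> y; rewrite subr0 ltr_pdivlMr // => yd.
  have y0 := nm_ge0 y.
  have := dP (q + y *: (rC c *: h)).
  rewrite (addrC q) addrK nmZ nch => H.
  have {}H : nm (a (y *: (rC c *: h) + q) - a q - 'd a q (y *: (rC c *: h)))
    <= b / (r / 4 + 1) * (nm y * (r / 4)).
    by apply: H; nra.
  rewrite /k scale0r addr0 (addrC q).
  have -> : 'd a q (rC c *: h) * y = 'd a q (y *: (rC c *: h)).
    by rewrite [RHS]linear_mul mulrC.
  apply: le_trans H _.
  have : b / (r / 4 + 1) * (nm y * (r / 4)) <= b / (r / 4 + 1) * (nm y * (r /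
    4 + 1)).
    rewrite ler_wpM2l ?ler_wpM2l //; last lra.
    by rewrite divr_ge0 // ltW.
  by have -> : b / (r / 4 + 1) * (nm y * (r / 4 + 1)) = b * nm y
    by rewrite mulrCA divfK ?gt_eqF // mulrC.
- rewrite ler_pdivrMr //; lra.
Qed.

End LimitOfDifferentials.

(** * Division by a linear form *)

Section Division.
Variables (R : realType) (V : normedModType (Cx R)).
Local Notation C := (Cx R).

Lemma nm_shift (u w p : V) : nm (u + w - p) <= nm (u - p) + nm w.
Proof. by rewrite addrAC; exact: nmD. Qed.

Lemma linear_bound (lam : {linear V -> C}) : continuous lam ->
  exists2 B : R, 0 < B & forall v, nm (lam v) <= B * nm v.
Proof.
move=> lc; have /continuous_nmP H := lc 0.
have [d d0 dP] := H 1 ltr01; have l0 : lam 0 = 0 by exact: linear0.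
exists (2 / d); first by rewrite divr_gt0.
move=> v; have [->|v0] := eqVneq v 0; first by rewrite l0 !nm0 mulr0.
have nv : 0 < nm v by rewrite nm_gt0.
pose c := d / (2 * nm v); have c0 : 0 < c by rewrite divr_gt0 ?mulr_gt0.
have := dP (rC c *: v); rewrite l0 !subr0 linear_mul nmM nmZ nm_real gtr0_norm
  //.
have -> : c * nm v = d / 2 by rewrite /c; field; rewrite gt_eqF.
move=> /(_ ltac:(lra)) /ltW; rewrite /c mulrAC ler_pdivrMr ?mulr_gt0 // => H1.
by rewrite mulrAC ler_pdivlMr // mulrC; lra.
Qed.

Section DivisionByLinearForm.
Variables (F : V -> C) (lam : {linear V -> C}) (e p : V).
Hypotheses (lam_cont : continuous lam) (lam_e : lam e = 1) (lam_p : lam p = 0).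

Let proj (v : V) := v - lam v *: e.

Let lam_proj (v : V) : lam (proj v) = 0.
Proof. by rewrite (linearB lam) linear_mul lam_e mulr1 subrr. Qed.

Let projK (v : V) : proj v + lam v *: e = v.
Proof. by rewrite subrK. Qed.

Let quot (v : V) : C := if lam v == 0 then 'd F v e else F v / lam v.

Variables (B M r : R).
Hypotheses (B_gt0 : 0 < B) (r_gt0 : 0 < r).
Hypotheses (lam_bound : forall v, nm (lam v) <= B * nm v).
Hypotheses (F_diff : forall v, nm (v - p) < r -> differentiable F v)
  (F_vanish : forall v, nm (v - p) < r -> lam v = 0 -> F v = 0)
  (F_bound : forall v, nm (v - p) < r -> nm (F v) <= M).

Let e_gt0 : 0 < nm e.
Proof.
rewrite nm_gt0; apply: contra_eq_neq lam_e => ->.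
by rewrite (linear0 lam) eq_sym oner_neq0.
Qed.

Let M_ge0 : 0 <= M.
Proof. by apply: le_trans (nm_ge0 (F p)) (F_bound _); rewrite subrr nm0. Qed.

(* The constant of line_estimate on balls of radius r / 2, for a displacement
   along e instead of h. *)
Let K := 512 * M / (r / 2) ^+ 2 * nm e ^+ 2.

Let K_ge0 : 0 <= K.
Proof.
apply: mulr_ge0 (sqr_ge0 _); apply: divr_ge0 (sqr_ge0 _).
exact: mulr_ge0 (ler0n _ _) M_ge0.
Qed.

Let tau := r / (16 * nm e).

Let tau_gt0 : 0 < tau.
Proof. by rewrite divr_gt0 ?mulr_gt0. Qed.

Let tau_e : tau * nm e = r / 16.
Proof. by rewrite /tau; field; rewrite gt_eqF. Qed.

Lemma transverse_estimate (u : V) (t : C) : lam u = 0 -> nm (u - p) < r / 2 ->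
  nm t <= tau ->
  nm (F (u + t *: e) - t * 'd F u e) <= K * nm t ^+ 2.
Proof.
have r0 := r_gt0.
move=> lu up tt.
have near_p (v : V) : nm (v - u) < r / 2 -> nm (v - p) < r.
  by move=> vu; have := nm_tri v u p; lra.
have r2 : 0 < r / 2 by rewrite divr_gt0.
have up' : nm (u - p) < r by lra.
have := @line_estimate _ _ F u (t *: e) (r / 2) M 1 r2 _ _ (oner_neq0 _) _ _ _.
rewrite linear_mul (F_vanish up' lu) subr0 nmZ.
rewrite [_ * (nm t * nm e) ^+ 2](_ : _ = K * nm t ^+ 2); last by rewrite /K;
  ring.
apply.
- by move=> v /near_p /F_diff; exact: differentiable_continuous.
- by move=> v /near_p; exact: F_bound.
- exact: F_diff.
- move=> s st _; apply: F_diff; apply: near_p.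
  by rewrite [u + _]addrC addrK.
- have : nm t * nm e <= tau * nm e by rewrite ler_pM2r.
  by rewrite tau_e; lra.
Qed.

(* For v in the ball of radius r1 about p, transverse_estimate applies to u =
   proj v and t = lam v. *)
Let r1 := Num.min (r / (2 * (1 + B * nm e))) (tau / B).

Let P_gt0 : 0 < 1 + B * nm e.
Proof. by rewrite ltr_wpDr // mulr_ge0 // ltW. Qed.

Let r1_gt0 : 0 < r1.
Proof. by rewrite lt_min !divr_gt0 ?mulr_gt0. Qed.

Let r1_le : r1 <= r / 2.
Proof.
rewrite ge_min; apply/orP; left.
rewrite ler_pdivrMr ?mulr_gt0 //.
have : 0 <= r * (B * nm e) by rewrite !mulr_ge0 // ltW.
have -> : r / 2 * (2 * (1 + B * nm e)) = r + r * (B * nm e) by field.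
by lra.
Qed.

Let lam_small (v : V) : nm (v - p) < r1 -> nm (lam v) <= tau.
Proof.
move=> vp; have -> : lam v = lam (v - p) by rewrite (linearB lam) lam_p subr0.
apply: le_trans (lam_bound _) _.
have : nm (v - p) <= tau / B by apply: ltW; apply: lt_le_trans vp _;
  rewrite ge_min lexx orbT.
by rewrite ler_pdivlMr // mulrC.
Qed.

Let proj_dist (v w : V) : nm (proj v - proj w) <= (1 + B * nm e) * nm (v - w).
Proof.
have -> : proj v - proj w = (v - w) - lam (v - w) *: e.
  rewrite /proj (linearB lam) scalerBl !opprB [_ *: e - w]addrC addrACA.
  by rewrite [- (_ *: e) + _]addrC.
apply: le_trans (nmB _ _) _; rewrite nmZ mulrDl mul1r lerD2l mulrAC.
by rewrite ler_pM2r.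
Qed.

Let proj_near (v : V) : nm (v - p) < r1 -> nm (proj v - p) < r / 2.
Proof.
move=> vp; have projp : proj p = p by rewrite /proj lam_p scale0r subr0.
rewrite -{1}projp; apply: le_lt_trans (proj_dist _ _) _.
have : nm (v - p) < r / (2 * (1 + B * nm e)).
  by apply: lt_le_trans vp _; rewrite ge_min lexx.
by rewrite ltr_pdivlMr ?mulr_gt0 //; lra.
Qed.

Lemma quotE (v : V) : nm (v - p) < r -> F v = lam v * quot v.
Proof.
move=> vp; rewrite /quot; case: eqVneq => [l0|l0].
  by rewrite l0 mul0r F_vanish.
by rewrite mulrC divfK.
Qed.

(** Off the kernel, quot v is the slope of F on the line from proj v in the
    direction e, where F starts from 0: it differs from the derivative at proj v
    by a bounded multiple of the distance to the kernel. *)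
Lemma quot_estimate (v : V) : nm (v - p) < r1 ->
  nm (quot v - 'd F (proj v) e) <= K * nm (lam v).
Proof.
move=> vp; rewrite /quot; case: eqVneq => [l0|l0].
  by rewrite /proj l0 scale0r subr0 subrr !nm0 mulr0.
have := transverse_estimate (lam_proj v) (proj_near vp) (lam_small vp).
rewrite projK -[lam v * _]mulrC.
have -> : F v - 'd F (proj v) e * lam v = (F v / lam v - 'd F (proj v) e) *
  lam v.
  by rewrite mulrBl divfK.
by rewrite nmM expr2 mulrA ler_pM2r // nm_gt0.
Qed.

Lemma transverse_derivative_bound (u : V) : lam u = 0 -> nm (u - p) < r / 2 ->
  nm ('d F u e) <= M / tau + K * tau.
Proof.
have r0 := r_gt0.
move=> lu up; have nt : nm (rC tau : C) = tau by rewrite nm_real gtr0_norm.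
have ntt : nm (rC tau : C) <= tau by rewrite nt.
have := transverse_estimate lu up ntt; rewrite nt => H.
have HF : nm (F (u + rC tau *: e)) <= M.
  apply: F_bound; apply: le_lt_trans (nm_shift _ _ _) _.
  by rewrite nmZ nt tau_e; lra.
have : nm (rC tau * 'd F u e) <= M + K * tau ^+ 2.
  have -> : rC tau * 'd F u e = F (u + rC tau *: e)
    - (F (u + rC tau *: e) - rC tau * 'd F u e) by ring.
  by apply: le_trans (nmB _ _) _; apply: lerD.
rewrite nmM nt mulrC -ler_pdivlMr // => /le_trans; apply.
by rewrite mulrDl expr2 [K * _]mulrA mulfK ?gt_eqF.
Qed.

Lemma quot_bound (v : V) : nm (v - p) < r1 ->
  nm (quot v) <= M / tau + K * tau + K * tau.
Proof.
move=> vp; apply: le_trans (nm_le_dist _ ('d F (proj v) e)) _.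
apply: lerD; first exact: transverse_derivative_bound (lam_proj v) (proj_near
  vp).
by apply: le_trans (quot_estimate vp) _; rewrite ler_wpM2l // lam_small.
Qed.

Lemma quot_differentiable_off (v : V) : nm (v - p) < r -> lam v != 0 ->
  differentiable quot v.
Proof.
move=> vp lv.
apply: (@near_eq_differentiable _ _ _ (fun w => F w * (lam w)^-1)).
  have /near_nmP[d d0 dP] : \forall w \near v, lam w != 0.
    exact: (@lam_cont v _ (near_neq lv)).
  apply/near_nmP; exists d => // w /dP lw.
  by rewrite /quot (negbTE lw).
have lam_diff : differentiable lam v by exact: linear_differentiable.
apply: (@differentiableM _ _ F (fun w => (lam w)^-1)); first exact: F_diff.
exact: (@differentiableV _ _ lam).
Qed.

(** At a point of the kernel, two values of the transverse derivative are
    compared through the slopes of F over one and the same small displacement t,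
    which depend continuously on the foot point. *)
Lemma quot_continuous (v : V) : nm (v - p) < r1 -> {for v, continuous quot}.
Proof.
have r0 := r_gt0; have r10 := r1_gt0; have r1r := r1_le.
move=> vp; have vr : nm (v - p) < r by lra.
have [lv|lv] := eqVneq (lam v) 0; last first.
  by apply: differentiable_continuous; exact: quot_differentiable_off.
have pv : proj v = v by rewrite /proj lv scale0r subr0.
have vr2 : nm (v - p) < r / 2 by lra.
apply/continuous_nmP => eps eps0.
have K1 : 0 < K + 1 by rewrite ltr_wpDl.
pose t := Num.min tau (eps / (8 * (K + 1))).
have t0 : 0 < t by rewrite lt_min tau_gt0 divr_gt0 ?mulr_gt0.
have t_tau : t <= tau by rewrite ge_min lexx.
have Kt : K * t <= eps / 8.
  have : t <= eps / (8 * (K + 1)) by rewrite ge_min lexx orbT.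
  by rewrite ler_pdivlMr ?mulr_gt0 //; lra.
have nt : nm (rC t : C) = t by rewrite nm_real gtr0_norm.
have shift_near (u : V) : nm (u - p) < r / 2 -> nm (u + rC t *: e - p) < r.
  move=> up; apply: le_lt_trans (nm_shift _ _ _) _.
  have : t * nm e <= tau * nm e by rewrite ler_pM2r.
  by rewrite nmZ nt tau_e; lra.
have /continuous_nmP Fc := differentiable_continuous (F_diff (shift_near v
  vr2)).
have [d d0 dP] := Fc (t * (eps / 8)) (mulr_gt0 t0 (divr_gt0 eps0 (ltr0Sn _ _))).
exists (Num.min (Num.min (d / (1 + B * nm e)) (r1 - nm (v - p))) (eps / (8 *
  (K + 1) * B))).
  by rewrite !lt_min subr_gt0 vp !divr_gt0 ?mulr_gt0.
move=> y; rewrite !lt_min => /andP[/andP[yd yr] yB].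
have yp : nm (y - p) < r1 by have := nm_tri y v p; lra.
have Hy := quot_estimate yp; have Hv := quot_estimate vp.
rewrite lv nm0 mulr0 pv in Hv.
have Kl : K * nm (lam y) <= eps / 8.
  have : nm (lam y) <= B * nm (y - v).
    by have -> : lam y = lam (y - v) by rewrite (linearB lam) lv subr0.
  move: yB; rewrite ltr_pdivlMr ?mulr_gt0 // => yB ly.
  have : K * nm (lam y) <= K * (B * nm (y - v)) by rewrite ler_wpM2l.
  have : 0 <= B * nm (y - v) by rewrite mulr_ge0 ?nm_ge0 // ltW.
  by lra.
have tt : nm (rC t : C) <= tau by rewrite nt.
have H1 := transverse_estimate (lam_proj y) (proj_near yp) tt.
have H2 := transverse_estimate lv vr2 tt.
have H3 : nm (F (proj y + rC t *: e) - F (v + rC t *: e)) < t * (eps / 8).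
  apply: dP; rewrite opprD addrACA subrr addr0 -[in X in _ - X]pv.
  by apply: le_lt_trans (proj_dist _ _) _; move: yd;
    rewrite ltr_pdivlMr // mulrC.
have H4 : nm ('d F (proj y) e - 'd F v e) <= 3 * (eps / 8).
  rewrite -(ler_pM2l t0) -{1}nt -nmM.
  have -> : rC t * ('d F (proj y) e - 'd F v e) =
    (F (proj y + rC t *: e) - F (v + rC t *: e))
    - (F (proj y + rC t *: e) - rC t * 'd F (proj y) e)
    + (F (v + rC t *: e) - rC t * 'd F v e) by ring.
  apply: le_trans (nmD _ _) _; apply: le_trans (lerD (nmB _ _) (lexx _)) _.
  have : K * t ^+ 2 <= t * (eps / 8) by rewrite expr2 mulrCA ler_pM2l.
  by rewrite nt in H1 H2; lra.
have -> : quot y - quot v = (quot y - 'd F (proj y) e)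
  + ('d F (proj y) e - 'd F v e) - (quot v - 'd F v e) by ring.
apply: le_lt_trans (nmB _ _) _; apply: le_lt_trans (lerD (nmD _ _) (lexx _)) _.
lra.
Qed.

(** At a point v of the kernel, the second-order estimates at the points q n,
    which tend to v from outside the kernel, are uniform: the line from q n in a
    direction h meets the kernel at most once, and not at q n, so that it has at
    most one exceptional parameter, x. *)
Lemma quot_differentiable (v : V) : nm (v - p) < r1 / 2 ->
  differentiable quot v.
Proof.
have r0 := r_gt0; have r10 := r1_gt0; have r1r := r1_le.
move=> vp; have vr : nm (v - p) < r by lra.
have [lv|lv] := eqVneq (lam v) 0; last exact: quot_differentiable_off.
pose sg := r1 / (8 * nm e); have sg0 : 0 < sg by rewrite divr_gt0 ?mulr_gt0.
pose s n := sg / 2 ^+ n; have s0 n : 0 < s n by rewrite divr_gt0 ?exprn_gt0.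
pose q n := v + rC (s n) *: e.
have ns n : nm (rC (s n) : C) = s n by rewrite nm_real gtr0_norm.
have s_le n : s n <= sg.
  by rewrite ler_pdivrMr ?exprn_gt0 // ler_peMr ?(ltW sg0) // exprn_ege1 //
    ler1n.
have se n : s n * nm e <= r1 / 8.
  have : s n * nm e <= sg * nm e by rewrite ler_pM2r.
  by have -> : sg * nm e = r1 / 8 by rewrite /sg; field; rewrite gt_eqF.
have lq n : lam (q n) = rC (s n)
  by rewrite (linearD lam) lv add0r linear_mul lam_e mulr1.
have qp n : nm (q n - p) < 5 / 8 * r1.
  apply: le_lt_trans (nm_shift _ _ _) _; rewrite nmZ ns.
  by have := se n; lra.
have in_ball n (w : V) : nm (w - q n) < r1 / 4 -> nm (w - p) < r1.
  by move=> wq; have := nm_tri w (q n) p; have := qp n; lra.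
have lq0 n : lam (q n) != 0 by rewrite lq -nm_gt0 ns.
pose L := 512 * (M / tau + K * tau + K * tau) / (r1 / 4) ^+ 2.
have L0 : 0 <= L.
  have Kt : 0 <= K * tau by rewrite mulr_ge0 // ltW.
  have Mt : 0 <= M / tau by rewrite divr_ge0 // ltW.
  apply: divr_ge0 (sqr_ge0 _); apply: mulr_ge0 (ler0n _ _) _.
  exact: addr_ge0 (addr_ge0 Mt Kt) Kt.
have r32 : 0 < r1 / 32 by rewrite divr_gt0.
apply: (@differentiable_limit _ _ quot v q (fun n =>
  'd quot (q n)) (r1 / 32) L r32 L0).
- move=> eps eps0.
  have [N NP] := small_dyadic sg0 (divr_gt0 eps0 e_gt0).
  exists N => n Nn; rewrite /q addrAC subrr add0r nmZ ns -ltr_pdivlMr //.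
  apply: le_lt_trans NP; rewrite ler_pM2l // lef_pV2 ?posrE ?exprn_gt0 //.
  by rewrite ler_weXn2l // ler1n.
- move=> h hr; apply: quot_continuous.
  by apply: le_lt_trans (nm_shift _ _ _) _; lra.
move=> n h hr.
pose x : C := if lam h == 0 then 1 else - lam (q n) / lam h.
have x0 : x != 0.
  rewrite /x; case: (eqVneq (lam h) 0) => [_|lh]; first by rewrite oner_eq0.
  by rewrite mulf_neq0 ?oppr_eq0 ?invr_eq0.
apply: (@line_estimate _ _ quot (q n) h (r1 / 4) _ x _ _ _ x0).
- by rewrite divr_gt0.
- by move=> w /in_ball; exact: quot_continuous.
- by move=> w /in_ball; exact: quot_bound.
- apply: quot_differentiable_off => //; have := qp n; lra.
- move=> t th tx; apply: quot_differentiable_off.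
    have : nm (q n + t *: h - p) < r1 by apply: (in_ball n);
      rewrite addrC addKr.
    by lra.
  rewrite (linearD lam) linear_mul; apply: contraNneq tx.
  rewrite /x; case: (eqVneq (lam h) 0) => [->|lh];
    first by rewrite mulr0 addr0 => /eqP; rewrite (negbTE (lq0 n)).
  move=> H; have -> : - lam (q n) = t * lam h; last by rewrite mulfK.
  by apply/eqP; rewrite eq_sym -addr_eq0 addrC H.
- lra.
Qed.

End DivisionByLinearForm.

(** The quotient is F / lam outside the kernel of lam and the derivative of F in
    the direction e on it. *)
Theorem holomorphic_division (F : V -> C) (lam : {linear V -> C}) (e p : V) :
  continuous lam -> lam e = 1 -> lam p = 0 ->
  (\forall v \near p, differentiable F v) ->
  (\forall v \near p, lam v = 0 -> F v = 0) ->
  exists a : V -> C, \forall v \near p, differentiable a v /\ F v = lam v * a v.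
Proof.
move=> lc le lp Fd Fv; have [B B0 lB] := linear_bound lc.
have Fb : \forall v \near p, nm (F v) <= nm (F p) + 1.
  have /continuous_nmP Fc := differentiable_continuous (nbhs_singleton Fd).
  have [d d0 dP] := Fc 1 ltr01.
  apply/near_nmP; exists d => // v /dP.
  by have := nm_le_dist (F v) (F p); lra.
have /near_nmP[r r0 rP] : \forall v \near p, [/\ differentiable F v,
    lam v = 0 -> F v = 0 & nm (F v) <= nm (F p) + 1].
  by apply: filterS3 Fd Fv Fb => v.
have Fdiff (v : V) : nm (v - p) < r -> differentiable F v by move=> /rP[].
have Fvan (v : V) : nm (v - p) < r -> lam v = 0 -> F v = 0 by move=> /rP[].
have Fbnd (v : V) : nm (v - p) < r -> nm (F v) <= nm (F p) + 1 by move=> /rP[].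
exists (fun v => if lam v == 0 then 'd F v e else F v / lam v).
have D := quot_differentiable lc le lp B0 r0 lB Fdiff Fvan Fbnd.
have E := quotE e Fvan.
set r' := Num.min _ _ / 2 in D.
have r'0 : 0 < r'.
  have e0 : 0 < nm e.
    rewrite nm_gt0; apply: contra_eq_neq le => ->.
    by rewrite (linear0 lam) eq_sym oner_neq0.
  have P0 : 0 < 1 + B * nm e by rewrite addr_gt0 ?mulr_gt0.
  by rewrite divr_gt0 // lt_min !divr_gt0 ?mulr_gt0.
apply/near_nmP; exists (Num.min r' r); first by rewrite lt_min r'0 r0.
by move=> v; rewrite lt_min => /andP[vr' vr]; split; [exact: D|exact: E].
Qed.

End Division.

(** * Hadamard's lemma *)

Section Hadamard.
Variables (R : realType) (V : normedModType (Cx R)).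
Local Notation C := (Cx R).
Variables (l : nat) (lam : 'I_l -> {linear V -> C}) (e : 'I_l -> V) (p : V).
Hypotheses (lam_cont : forall i, continuous (lam i))
  (lam_dual : forall i j, lam i (e j) = (i == j)%:R)
  (lam_p : forall i, lam i p = 0).

Let proj i v := v - lam i v *: e i.

Let proj_p i : proj i p = p.
Proof. by rewrite /proj lam_p scale0r subr0. Qed.

Let lam_proj i j v : lam i (proj j v) = lam i v - (i == j)%:R * lam j v.
Proof. by rewrite (linearB (lam i)) linear_mul lam_dual mulrC. Qed.

Let proj_diff i v : differentiable (proj i) v.
Proof.
apply: differentiableB; first exact: differentiable_id.
apply: (@differentiableZl _ _ _ (lam i)); exact: linear_differentiable.
Qed.

Let near_proj i (P : set V) :
  (\forall v \near p, P v) -> \forall v \near p, P (proj i v).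
Proof.
move=> Pp; have c := differentiable_continuous (proj_diff i p).
by apply: (c P); rewrite proj_p.
Qed.

(** Induction on the number of forms that must vanish for G to vanish: G minus
    its composite with the projection along one e i vanishes on the kernel of
    lam i, hence is divisible by lam i, and that composite vanishes under one
    condition less. *)
Theorem hadamard (G : V -> C) :
  (\forall v \near p, differentiable G v) ->
  (\forall v \near p, (forall i, lam i v = 0) -> G v = 0) ->
  exists a : 'I_l -> V -> C, \forall v \near p,
    (forall i, differentiable (a i) v) /\ G v = \sum_i lam i v * a i v.
Proof.
suff IHl k : (k <= l)%N -> forall G : V -> C,
    (\forall v \near p, differentiable G v) ->
    (\forall v \near p, (forall i : 'I_l, (i < k)%N -> lam i v = 0) ->
      G v = 0) ->
    exists a : 'I_l -> V -> C, \forall v \near p,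
      (forall i, differentiable (a i) v) /\ G v = \sum_i lam i v * a i v.
  move=> dG vG; apply: (IHl l) => //.
  by apply: filterS vG => v H Hi; apply: H => i; exact: Hi.
elim: k => [|k IH] kl {}G dG vG.
  exists (fun _ _ => 0); apply: filterS vG => v ->//.
  split=> [i|]; first exact: differentiable_cst.
  by rewrite big1 // => i _; rewrite mulr0.
pose i0 := Ordinal kl.
have dGp : \forall v \near p, differentiable (G \o proj i0) v.
  by apply: filterS (near_proj i0 dG) => v dv; exact: differentiable_comp.
have [|a aP] := IH (ltnW kl) (G \o proj i0) dGp.
  apply: filterS (near_proj i0 vG) => v Gv H; apply: Gv => i ik.
  rewrite lam_proj; have [->|ii0] := eqVneq i i0; first by rewrite mul1r subrr.
  rewrite mul0r subr0; apply: H; move: ik;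
    rewrite ltnS leq_eqVlt => /orP[/eqP ik|//].
  by case/eqP: ii0; apply: val_inj.
have [||||b bP] := @holomorphic_division _ _ (fun v => G v - (G \o proj i0) v)
    (lam i0) (e i0) p (@lam_cont i0).
- by rewrite lam_dual eqxx.
- exact: lam_p.
- by apply: filterS2 dG dGp => v d1 d2; exact: differentiableB.
- by apply: nearW => v lv; rewrite /= /proj lv scale0r subr0 subrr.
exists (fun i v => a i v + (i == i0)%:R * b v).
apply: filterS2 aP bP => v [da ea] [db eb]; split.
  move=> i; apply: differentiableD => //.
  apply: (@differentiableM _ _ (cst ((i == i0)%:R : C)) b) db.
  exact: (differentiable_cst ((i == i0)%:R : C)).
have -> : G v = (G \o proj i0) v + (G v - (G \o proj i0) v)
  by rewrite addrC subrK.
rewrite eb ea; transitivity (\sum_i (lam i v * a i v) +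
  \sum_i (lam i v * ((i == i0)%:R * b v))); last first.
  by rewrite -big_split; apply: eq_bigr => i _; rewrite mulrDr.
congr (_ + _); rewrite (bigD1 i0) //= eqxx mul1r big1 ?addr0 // => i /negbTE ->.
by rewrite mul0r mulr0.
Qed.

End Hadamard.

(** * Holomorphic maps between charted spaces *)

Section HolomorphicCalculus.
Variable R : realType.
Local Notation C := (Cx R).
Implicit Types U V W : normedModType C.

Lemma near_dom V (X : charted V) (c : chart X V) x : dom c x ->
  \forall y \near x, dom c y.
Proof. by move=> cx; apply: open_nbhs_nbhs; split=> //; exact: dom_open. Qed.

Lemma near_cod V (X : topologicalType) (c : chart X V) v : cod c v ->
  \forall w \near v, cod c w.
Proof. by move=> cv; apply: open_nbhs_nbhs; split=> //; exact: cod_open. Qed.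

Lemma cdiff_to_euclid V W (X : charted V) (f : X -> W) x :
  cdiff_at (Y := euclid W) f x <-> {for x, continuous f} /\
  forall c, atlas c -> dom c x -> differentiable (f \o bwd c) (fwd c x).
Proof.
split=> -[fc fd]; (split; first exact: fc).
  by move=> c Ac cx; exact: (fd c (id_chart W) Ac erefl cx I).
by move=> c _ Ac -> cx _; exact: (fd c Ac cx).
Qed.

Lemma cdiff_euclid V W (f : V -> W) v :
  cdiff_at (X := euclid V) (Y := euclid W) f v <-> differentiable f v.
Proof.
rewrite cdiff_to_euclid; split=> [[_ fd]|df].
  exact: (fd (id_chart V) erefl I).
split; first exact: differentiable_continuous.
by move=> _ -> _.
Qed.

Lemma cdiff_fwd V (X : charted V) (c : chart X V) x : atlas c -> dom c x ->
  cdiff_at (Y := euclid V) (fwd c) x.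
Proof.
move=> Ac cx; apply/cdiff_to_euclid; split; first exact: fwd_continuous.
by move=> c' Ac' c'x; exact: atlas_compat.
Qed.

Lemma cdiff_bwd V (X : charted V) (c : chart X V) v : atlas c -> cod c v ->
  cdiff_at (X := euclid V) (bwd c) v.
Proof.
move=> Ac cv; split; first exact: bwd_continuous.
move=> _ c' -> Ac' _ c'v; have := atlas_compat Ac Ac' (bwd_fun cv) c'v.
by rewrite bwdK.
Qed.

Lemma cdiff_pair U V W (X : charted U) (Y : charted V) (T : charted W)
    (f : X -> Y) (g : X -> T) x : cdiff_at f x -> cdiff_at g x ->
  cdiff_at (Y := prodc Y T) (fun y => (f y, g y)) x.
Proof.
move=> [fc fd] [gc gd]; split; first exact: cvg_pair.
move=> c _ Ac [c1 [c2 [Ac1 Ac2 ->]]] cx [/= c1x c2x].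
apply: (@differentiable_pair _ _ _ _ (fwd c1 \o f \o bwd c) (fwd c2 \o g \o
  bwd c)).
  exact: fd.
exact: gd.
Qed.

Lemma cdiff_fst V W (X : charted V) (Y : charted W) (q : prodc X Y) :
  cdiff_at (X := prodc X Y) (fun q : prodc X Y => q.1) q.
Proof.
split; first by case: q => x y; exact: cvg_fst.
move=> _ c' [c [d [Ac Ad ->]]] Ac' [/= cq dq] c'q.
apply: (@differentiable_comp _ _ _ _ fst (fwd c' \o bwd c)).
  by apply: (@linear_differentiable _ _ _ fst) => ?; exact: cvg_fst.
exact: atlas_compat.
Qed.

Lemma cdiff_snd V W (X : charted V) (Y : charted W) (q : prodc X Y) :
  cdiff_at (X := prodc X Y) (fun q : prodc X Y => q.2) q.
Proof.
split; first by case: q => x y; exact: cvg_snd.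
move=> _ d' [c [d [Ac Ad ->]]] Ad' [/= cq dq] d'q.
apply: (@differentiable_comp _ _ _ _ snd (fwd d' \o bwd d)).
  by apply: (@linear_differentiable _ _ _ snd) => ?; exact: cvg_snd.
exact: atlas_compat.
Qed.

Lemma differentiable_row V n (f : V -> 'rV[C]_n) v :
  (forall i, differentiable (fun w => f w 0 i) v) -> differentiable f v.
Proof.
move=> df.
have -> : f = \sum_(i < n) (fun w => f w 0 i *: delta_mx 0 i).
  apply/funext => w; rewrite [LHS]row_sum_delta.
  by elim/big_ind2: _ => [//|g x h y -> ->|i _].
apply: differentiable_sum => i; exact: differentiableZl.
Qed.

Lemma differentiable_rowP V n (f : V -> 'rV[C]_n) v :
  differentiable f v <-> forall i, differentiable (fun w => f w 0 i) v.
Proof.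
split=> [df i|]; last exact: differentiable_row.
apply: (@differentiable_comp _ _ _ _ f (fun M : 'rV[C]_n => M 0 i)) => //.
exact: differentiable_coord.
Qed.

Lemma differentiable_chart_continuous V W (X : charted V) (f : X -> W)
    (c : chart X V) x : dom c x -> differentiable (f \o bwd c) (fwd c x) ->
  {for x, continuous f}.
Proof.
move=> cx /differentiable_continuous fc.
apply: (@near_eq_continuous _ _ ((f \o bwd c) \o fwd c)).
  by apply: filterS (near_dom cx) => y cy; rewrite /= fwdK.
by apply: continuous_comp fc; exact: fwd_continuous.
Qed.

Lemma cdiff_rowP V (X : charted V) n (f : X -> 'rV[C]_n) x :
  cdiff_at (Y := euclid 'rV[C]_n) f x <->
  forall i, cdiff_fun_at (fun y => f y 0 i) x.
Proof.
split=> [df i|df].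
  apply: (@cdiff_at_comp _ _ _ _ _ (euclid 'rV[C]_n) (euclid C) f (fun M :
    'rV[C]_n => M 0 i)) => //.
  by apply/cdiff_euclid; exact: differentiable_coord.
have fd c : atlas c -> dom c x -> differentiable (f \o bwd c) (fwd c x).
  move=> Ac cx; apply/differentiable_rowP => i.
  by have /cdiff_to_euclid [_] := df i; apply.
apply/cdiff_to_euclid; split=> //; have [c Ac cx] := atlas_cover x.
by apply: (differentiable_chart_continuous cx); exact: fd.
Qed.

Lemma cdiff_cst V W (X : charted V) (y : W) x :
  cdiff_at (Y := euclid W) (fun _ : X => y) x.
Proof.
apply/cdiff_to_euclid; split; first exact: cst_continuous.
by move=> c _ _; exact: (differentiable_cst y).
Qed.

Lemma cdiffD V W (X : charted V) (f g : X -> W) x :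
  cdiff_at (Y := euclid W) f x -> cdiff_at (Y := euclid W) g x ->
  cdiff_at (Y := euclid W) (fun y => f y + g y) x.
Proof.
move=> /cdiff_to_euclid[fc fd] /cdiff_to_euclid[gc gd]; apply/cdiff_to_euclid.
split; first exact: cvgD fc gc.
by move=> c Ac cx; apply: differentiableD; [exact: fd|exact: gd].
Qed.

Lemma cdiffB V W (X : charted V) (f g : X -> W) x :
  cdiff_at (Y := euclid W) f x -> cdiff_at (Y := euclid W) g x ->
  cdiff_at (Y := euclid W) (fun y => f y - g y) x.
Proof.
move=> /cdiff_to_euclid[fc fd] /cdiff_to_euclid[gc gd]; apply/cdiff_to_euclid.
split; first exact: cvgB fc gc.
by move=> c Ac cx; apply: differentiableB; [exact: fd|exact: gd].
Qed.

Lemma cdiff_div V (X : charted V) (f g : X -> C) x : g x != 0 ->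
  cdiff_fun_at f x -> cdiff_fun_at g x -> cdiff_fun_at (fun y => f y / g y) x.
Proof.
move=> gx /cdiff_to_euclid[fc fd] /cdiff_to_euclid[gc gd];
  apply/cdiff_to_euclid.
have gVc := @continuousV C X g x gx gc.
split; first exact: (@continuousM C X f (fun y => (g y)^-1) x fc gVc).
move=> c Ac cx.
apply: (@differentiableM _ _ (f \o bwd c) (fun v => (g (bwd c v))^-1));
  first exact: fd.
by apply: (@differentiableV _ _ (g \o bwd c)); [exact: gd|rewrite /= fwdK].
Qed.

End HolomorphicCalculus.

(** * A criterion for complete intersections *)

Section CompleteIntersectionCriterion.
Variables (R : realType) (V W : normedModType (Cx R)).
Variables (X : charted V) (Y : charted W).
Local Notation C := (Cx R).

Lemma complete_intersection_empty (B : set Y) (j : X -> Y) l : (0 < l)%N ->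
  complete_intersection set0 B j l.
Proof.
move=> l0; exists (fun _ _ => 1); split; first by move=> i y _;
  exact: cdiff_cst.
split=> [D g oO OB hg|D h oO OB _ p Op]; last first.
  by exists D, (fun=> 0); split=> // q _; exact: cdiff_cst.
split=> [_ p Op|//]; exists D, (fun i =>
  if i == Ordinal l0 then g else (fun=> 0)).
split=> // [i|q Oq].
  by case: eqP => _ // q _; exact: cdiff_cst.
rewrite (bigD1 (Ordinal l0)) //= ?eqxx mulr1 big1 ?addr0 // => i /negbTE ->.
by rewrite mul0r.
Qed.

(** The image of j is the zero set of f, and j composed with ret retracts a
    neighbourhood onto it. T (y, u) stands for the solution of f = u with the
    same retraction as y; accordingly T (y, f y) = y and T (y, 0) = j (ret y).
    *)
Section Criterion.
Variables (U : set X) (B : set Y) (j : X -> Y) (ret : Y -> X).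
Variables (l : nat) (f : Y -> 'rV[C]_l).
Local Notation E := (euclid 'rV[C]_l).
Hypotheses (U_open : open U)
  (j_cont : forall x, U x -> {for x, continuous j})
  (f_hol : forall y, B y -> cdiff_at (Y := E) f y)
  (j_zero : forall x, U x -> f (j x) = 0)
  (zero_j : forall y, B y -> f y = 0 -> exists2 x, U x & y = j x)
  (ret_hol : forall x, U x -> \forall y \near j x, cdiff_at ret y)
  (retj : forall x, U x -> ret (j x) = x)
  (straighten : forall x, U x -> exists T : prodc Y E -> Y,
     [/\ \forall q \near ((j x, 0) : prodc Y E), cdiff_at T q,
         \forall y \near j x, T (y, f y) = y &
         \forall y \near j x, T (y, 0) = j (ret y)]).

Let ret_near x (P : set X) : U x -> (\forall z \near x, P z) ->
  \forall y \near j x, P (ret y).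
Proof.
move=> Ux Px; have [rc _] := nbhs_singleton (ret_hol Ux).
by apply: (rc P); rewrite retj.
Qed.

Let near_U x : U x -> \forall z \near x, U z.
Proof. by move=> Ux; apply: open_nbhs_nbhs. Qed.

Let ideal_off_zero (D : set Y) (g : Y -> C) p : open D -> D `<=` B ->
  holomorphic_fun D g -> D p -> f p <> 0 ->
  exists (D' : set Y) (a : 'I_l -> Y -> C),
    [/\ open D', D' p, D' `<=` D, forall i, holomorphic_fun D' (a i) &
        forall q, D' q -> g q = \sum_(i < l) a i q * f q 0 i].
Proof.
move=> oO OB hg Op fp.
have [i fi] : exists i, f p 0 i != 0.
  apply: contrapT => H; apply: fp; apply/rowP => i; rewrite mxE.
  by apply/eqP; apply: contrapT => /negP fi; apply: H; exists i.
have fhol k y : D y -> cdiff_fun_at (fun y => f y 0 k) y.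
  by move=> /OB /f_hol /cdiff_rowP; apply.
have near_good : \forall y \near p, D y /\ f y 0 i != 0.
  have On : \forall y \near p, D y by exact: open_nbhs_nbhs.
  have [fc _] := fhol i p Op.
  by apply: filterS2 On (fc _ (near_neq fi)) => y.
exists [set y | D y /\ f y 0 i != 0]^°,
  (fun k => if k == i then (fun y => g y / f y 0 i) else (fun=> 0)).
have sub y : [set y | D y /\ f y 0 i != 0]^° y -> D y /\ f y 0 i != 0.
  by move=> H; exact: (nbhs_singleton H).
split.
- exact: open_interior.
- exact: near_good.
- by move=> y /sub[].
- move=> k y /sub[Oy fy]; case: eqP => [_|_]; last exact: cdiff_cst.
  by apply: cdiff_div => //; [exact: hg|exact: fhol].
- move=> q /sub[Oq fq]; rewrite (bigD1 i) //= eqxx divfK // big1 ?addr0 //.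
  by move=> k /negbTE ->; rewrite mul0r.
Qed.

(* The function g (T (y, u)) vanishes for u = 0, since T (y, 0) is in the image
   of j. By Hadamard's lemma, g (T (y, u)) = sum_i u_i a_i (y, u); substituting
   u = f y gives g y = sum_i f_i y * a_i (y, f y). *)
Let ideal_on_zero (D : set Y) (g : Y -> C) x : open D -> D `<=` B ->
  holomorphic_fun D g -> (forall x, U x -> D (j x) -> g (j x) = 0) ->
  U x -> D (j x) ->
  exists (D' : set Y) (a : 'I_l -> Y -> C),
    [/\ open D', D' (j x), D' `<=` D, forall i, holomorphic_fun D' (a i) &
        forall q, D' q -> g q = \sum_(i < l) a i q * f q 0 i].
Proof.
move=> oO OB hg g0 Ux Ojx; set p := j x.
have [T [Thol Tf T0]] := straighten Ux; rewrite -/p in Thol Tf T0.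
have fp : f p = 0 by exact: j_zero.
have [c Ac cp] := atlas_cover p.
pose c1 := prod_chart c (id_chart 'rV[C]_l).
have Ac1 : @atlas _ _ (prodc Y E) c1 by exists c, (id_chart 'rV[C]_l).
pose G (q : W * 'rV[C]_l) : C := g (T (bwd c q.1, q.2)).
pose p1 : W * 'rV[C]_l := (fwd c p, 0).
have p1E : p1 = fwd c1 ((p, 0) : prodc Y E) by [].
have c1p : dom c1 (p, 0) by split.
have Tp : T (p, 0) = p by have := nbhs_singleton Tf; rewrite fp.
have On : \forall y \near p, D y by exact: open_nbhs_nbhs.
have OT : \forall q \near ((p, 0) : prodc Y E), D (T q).
  have [Tc _] := nbhs_singleton Thol.
  by apply: (Tc D); rewrite Tp.
have gT : \forall q \near ((p, 0) : prodc Y E),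
    cdiff_fun_at (X := prodc Y E) (g \o T) q.
  by apply: filterS2 Thol OT => q Tq Oq; apply: cdiff_at_comp Tq _; exact: hg.
have Gdiff : \forall q \near p1, differentiable G q.
  have H : \forall q \near p1, cod c1 q by apply: near_cod; split=> //;
    exact: fwd_fun.
  have H2 := bwd_near c1p gT; rewrite -p1E in H2.
  apply: filterS2 H H2 => q cq /cdiff_to_euclid[_ /(_ c1 Ac1 (bwd_fun cq))].
  by rewrite bwdK.
pose lam (i : 'I_l) (q : W * 'rV[C]_l) : C := q.2 0 i.
have Gvan : \forall q \near p1, (forall i, lam i q = 0) -> G q = 0.
  have H : \forall y \near p, g (T (y, 0)) = 0.
    have Oj : \forall y \near p, D (j (ret y)).
      by apply: (ret_near Ux (P := fun z => D (j z))); exact: (j_cont Ux).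
    have HU := ret_near Ux (near_U Ux).
    by apply: filterS3 T0 HU Oj => y -> Uy Oy; exact: g0.
  have H1 := bwd_near cp H.
  have H2 : \forall q \near p1, g (T (bwd c q.1, 0)) = 0.
    have fst_c : {for p1, continuous (fun q : W * 'rV[C]_l => q.1)}
      by exact: cvg_fst.
    exact: (fst_c _ H1).
  apply: filterS H2 => -[v w] /= H3 w0; rewrite /G /=.
  by have -> : w = 0 by apply/rowP => i; rewrite [LHS]w0 mxE.
have lamL i : linear (lam i) by move=> k u v; rewrite /lam /= !mxE.
pose Lam (i : 'I_l) : {linear (W * 'rV[C]_l)%type -> C} :=
  HB.pack (lam i) (GRing.isLinear.Build _ _ _ _ (lam i) (lamL i)).
have LamC i : continuous (Lam i).
  move=> q; apply: (@differentiable_continuous _ _ _ q (lam i)).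
  apply: (@differentiable_comp _ _ _ _ snd (fun M : 'rV[C]_l => M 0 i)).
    by apply: (@linear_differentiable _ _ _ snd) => ?; exact: cvg_snd.
  exact: differentiable_coord.
have [||a aP] := @hadamard _ _ l Lam (fun i =>
  (0, delta_mx 0 i)) p1 LamC _ _ G Gdiff Gvan.
- by move=> i k; rewrite /= /lam /= mxE eqxx eq_sym.
- by move=> i; rewrite /= /lam /= mxE.
pose s (y : Y) : W * 'rV[C]_l := (fwd c y, f y).
have s_hol y : dom c y -> D y -> cdiff_at (Y := euclid (W * 'rV[C]_l)%type) s y.
  move=> cy Dy; have sd c' : atlas c' -> dom c' y ->
    differentiable (s \o bwd c') (fwd c' y).
    move=> Ac' c'y; apply: (@differentiable_pair _ _ _ _ (fwd c \o bwd c') (f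
      \o bwd c')).
      exact: atlas_compat.
    by have /cdiff_to_euclid[_] := f_hol (OB _ Dy); apply.
  apply/cdiff_to_euclid; split=> //.
  by apply: (differentiable_chart_continuous cy); exact: sd.
have near_s (P : set (W * 'rV[C]_l)) : (\forall q \near p1, P q) ->
    \forall y \near p, P (s y).
  move=> Pp1; have [sc _] := s_hol p cp Ojx.
  by apply: (sc P); rewrite /s fp.
pose good := [set y | [/\ D y, dom c y, T (y, f y) = y,
  forall i, differentiable (a i) (s y) & G (s y) = \sum_i Lam i (s y) * a i (s
    y)]].
have good_near : \forall y \near p, good y.
  have H1 := near_s _ aP; have H2 := near_dom cp.
  by apply: filterS2 (filterI On H2) (filterI Tf H1) => y [? ?] [? []].
have sub y : good^° y -> good y by move=> H; exact: (nbhs_singleton H).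
exists good^°, (fun i y => a i (s y)); split.
- exact: open_interior.
- exact: good_near.
- by move=> y /sub[].
- move=> i y /sub[Oy cy _ da _].
  apply: (@cdiff_at_comp _ _ _ _ _ (euclid (W * 'rV[C]_l)%type) (euclid C) s
    (a i)); first exact: s_hol.
  by apply/cdiff_euclid; exact: da.
- move=> y /sub[Oy cy Ty _]; rewrite /G /s /= fwdK // Ty => ->.
  by apply: eq_bigr => i _; rewrite mulrC.
Qed.

(** Outside the zero set of f, one of the f_i is invertible; on it, the two
    conditions follow from Hadamard's lemma and from the retraction. *)
Theorem complete_intersection_criterion : complete_intersection U B j l.
Proof.
exists (fun i y => f y 0 i); split.
  by move=> i y /f_hol /cdiff_rowP; apply.
split=> [D g oO OB hg|D h oO OB hh p Op].
  split=> [g0 p Op|gI x Ux Ojx]; last first.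
    have [D' [a [_ D'x _ _ ->//]]] := gI _ Ojx.
    by rewrite big1 // => i _; rewrite j_zero // mxE mulr0.
  have [fp|fp] := pselect (f p = 0); last exact: ideal_off_zero.
  have [x Ux px] := zero_j (OB _ Op) fp; subst p.
  exact: ideal_on_zero.
have [fp|fp] := pselect (f p = 0); last first.
  have near_good : \forall y \near p, D y /\ f y != 0.
    have On : \forall y \near p, D y by exact: open_nbhs_nbhs.
    have [i fi] : exists i, f p 0 i != 0.
      apply: contrapT => H; apply: fp; apply/rowP => i; rewrite mxE.
      by apply/eqP; apply: contrapT => /negP fi; apply: H; exists i.
    have /cdiff_rowP /(_ i) [fc _] := f_hol (OB _ Op).
    apply: filterS2 On (fc _ (near_neq fi)) => y Oy /= fy; split=> //.
    by apply: contraNneq fy => ->; rewrite mxE.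
  exists [set y | D y /\ f y != 0]^°, (fun=> 0); split.
  - exact: open_interior.
  - exact: near_good.
  - by move=> y H; have [] := nbhs_singleton H.
  - by move=> y _; exact: cdiff_cst.
  - by move=> x Ux H; have [_] := nbhs_singleton H; rewrite j_zero // eqxx.
have [x Ux px] := zero_j (OB _ Op) fp; subst p.
pose good := [set y | [/\ D y, U (ret y), D (j (ret y)) & cdiff_at ret y]].
have good_near : \forall y \near j x, good y.
  have On : \forall y \near j x, D y by exact: open_nbhs_nbhs.
  have Oj : \forall y \near j x, D (j (ret y)).
    by apply: (ret_near Ux (P := fun z => D (j z))); exact: (j_cont Ux).
  have HU := ret_near Ux (near_U Ux); have HR := ret_hol Ux.
  by apply: filterS2 (filterI On Oj) (filterI HU HR) => y [? ?] [? ?].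
have sub y : good^° y -> good y by move=> H; exact: (nbhs_singleton H).
exists good^°, (h \o ret); split.
- exact: open_interior.
- exact: good_near.
- by move=> y /sub[].
- move=> y /sub[_ Uy Oy ry]; apply: cdiff_at_comp ry _; exact: hh.
- by move=> z Uz _; rewrite /= retj.
Qed.

End Criterion.
End CompleteIntersectionCriterion.

(** * Neighbourhoods adapted to an open cover *)

Section StarNeighbourhoods.
Variable X : topologicalType.
Hypotheses (X_hausdorff : hausdorff_space X) (X_paracompact : paracompact X).

Lemma nbhs_finite_bigcap (x : X) (S : set (set X)) (f : set X -> set X) :
  finite_set S -> (forall B, S B -> nbhs x (f B)) ->
  nbhs x (\bigcap_(B in S) f B).
Proof.
move=> /finite_fsetP[s ->] H; apply: filter_bigI => B Bs; exact: H.
Qed.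

(** Cover X by A and by the open sets that some neighbourhood of x avoids, and
    refine this cover to a locally finite one G. The members of G avoided by a
    neighbourhood of x cover the complement of A, and only finitely many of them
    come close to x, so that some neighbourhood of x avoids them all. *)
Lemma paracompact_regular (x : X) (A : set X) : open A -> A x ->
  exists D : set X, [/\ open D, D x & closure D `<=` A].
Proof.
move=> oA Ax.
pose away (V : set X) := exists2 N, nbhs x N & N `&` V = set0.
have [||G [Go Gcov Gref Glf]] := X_paracompact (F :=
  [set V | open V /\ (V = A \/ away V)]).
- by move=> V [].
- apply/seteqP; split=> // y _; have [Ay|nAy] := pselect (A y).
    by exists A => //; split=> //; left.
  have xy : x != y by apply: contra_notN nAy => /eqP <-.
  have := X_hausdorff; rewrite open_hausdorff => /(_ x y xy).
  move=> [[P Q] /= [/set_mem Px /set_mem Qy] [oP oQ /eqP PQ]].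
  exists Q => //; split=> //; right; exists P => //.
  exact: open_nbhs_nbhs.
have [N Nx Nfin] := Glf x.
have sep (B : set X) : exists M, nbhs x M /\ (away B -> M `&` B = set0).
  have [[M Mx MB]|nB] := pselect (away B); first by exists M.
  by exists setT; split => //; exact: filterT.
have [M MP] := choice sep.
pose S := [set B | G B /\ B `&` N !=set0].
pose D := (N `&` \bigcap_(B in S) M B)^°.
exists D; split.
- exact: open_interior.
- apply: filterI => //; apply: nbhs_finite_bigcap => // B _; exact: (MP B).1.
- move=> y Oy; apply: contrapT => nAy.
  have [B GB By] : (\bigcup_(B in G) B) y by rewrite Gcov.
  have [V [oV VA] BV] := Gref B GB.
  have aB : away B.
    case: VA => [VA|[L Lx LV]]; first by case: nAy; rewrite -VA; exact: BV.
    exists L => //; apply/seteqP; split=> // z [Lz Bz].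
    by rewrite -LV; split=> //; exact: BV.
  have [z [/interior_subset [Nz Mz] Bz]] : (D `&` B) !=set0.
    by apply: Oy; apply: open_nbhs_nbhs; split=> //; exact: Go.
  have SB : S B by split=> //; exists z.
  have : (M B `&` B) z by split=> //; exact: Mz.
  by rewrite ((MP B).2 aB).
Qed.

(** Refine F to a locally finite cover G such that the closure of each B in G
    lies in some A B in F. The neighbourhood N z is contained in A B for all B
    whose closure contains z, and it avoids the other B. If x is in B, then each
    N z containing x meets B, hence is contained in A B. *)
Lemma star_neighbourhoods (F : set (set X)) : F `<=` open ->
  \bigcup_(A in F) A = setT ->
  exists N : X -> set X, (forall z, nbhs z (N z)) /\
    forall x, exists2 A, F A & forall z, N z x -> N z `<=` A.
Proof.
move=> Fo Fcov.
have [||G [Go Gcov Gref Glf]] := X_paracompact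
    (F := [set V | open V /\ exists2 A, F A & closure V `<=` A]).
- by move=> V [].
- apply/seteqP; split=> // y _.
  have [A FA Ay] : (\bigcup_(A in F) A) y by rewrite Fcov.
  have [D [oO Oy OA]] := paracompact_regular (Fo _ FA) Ay.
  by exists D => //; split=> //; exists A.
have pick_A (B : set X) : exists A, G B -> F A /\ closure B `<=` A.
  have [GB|nGB] := pselect (G B); last by exists set0.
  have [V [_ [A FA VA]] BV] := Gref B GB.
  by exists A => _; split=> //; apply: subset_trans VA; exact: closure_subset.
have [A AP] := choice pick_A.
have nb (z : X) : exists N, nbhs z N /\ forall B x, G B -> B x -> N x ->
  N `<=` A B.
  have [N0 N0z N0fin] := Glf z.
  pose S := [set B | G B /\ B `&` N0 !=set0].
  pose f B := if pselect (closure B z) then A B else ~` closure B.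
  exists (N0 `&` \bigcap_(B in S) f B); split.
    apply: filterI => //; apply: nbhs_finite_bigcap => // B [GB _].
    rewrite /f; case: pselect => [Bz|nBz].
      have [FA BA] := AP B GB.
      by apply: open_nbhs_nbhs; split; [exact: Fo|exact: BA].
    apply: open_nbhs_nbhs; split=> //; apply: closed_openC;
      exact: closed_closure.
  move=> B x GB Bx [N0x Nx].
  have SB : S B by split=> //; exists x.
  move: (Nx B SB) => fx y [N0y Ny]; move: (Ny B SB) fx; rewrite /f.
  by case: pselect => [Bz //|nBz _ nBx]; case: nBx; exact: subset_closure.
have [N NP] := choice nb.
exists N; split=> [z|x]; first by case: (NP z).
have [B GB Bx] : (\bigcup_(B in G) B) x by rewrite Gcov.
exists (A B); first by case: (AP B GB).
by move=> z Nzx; exact: (NP z).2 B x GB Bx Nzx.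
Qed.

End StarNeighbourhoods.

(** * Graph charts *)

Section Polycylinders.
Variable R : realType.
Local Notation C := (Cx R).

Lemma polycylinderP n (a : 'rV[C]_n) (r : R) x :
  polycylinder a r x <-> forall i, nm (x 0 i - a 0 i) < r.
Proof. by split=> H i; have := H i; rewrite /polycylinder /= nmE ltcR. Qed.

Lemma polycylinder_center n (a : 'rV[C]_n) (r : R) : 0 < r ->
  polycylinder a r a.
Proof. by move=> r0; apply/polycylinderP => i; rewrite subrr nm0. Qed.

Lemma polycylinder_mono n (a : 'rV[C]_n) (r s : R) : r <= s ->
  polycylinder a r `<=` polycylinder a s.
Proof.
move=> rs x /polycylinderP H; apply/polycylinderP => i.
exact: lt_le_trans (H i) rs.
Qed.

Lemma near_polycylinder n (a : 'rV[C]_n) (r : R) x : polycylinder a r x ->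
  \forall y \near x, polycylinder a r y.
Proof.
move=> /polycylinderP H.
have near_i i : \forall y \near x, nm ((y : 'rV[C]_n) 0 i - a 0 i) < r.
  have c : {for x, continuous (fun M : 'rV[C]_n => M 0 i)}.
    by apply: differentiable_continuous; exact: differentiable_coord.
  suff N : \forall t \near x 0 i, nm (t - a 0 i) < r by exact: (c _ N).
  apply/near_nmP; exists (r - nm (x 0 i - a 0 i)); first by rewrite subr_gt0.
  by move=> t tx; have := nm_tri t (x 0 i) (a 0 i); lra.
have := @filter_forall _ _ (fun i (y : 'rV[C]_n) => nm (y 0 i - a 0 i) < r)
  _ (nbhs_filter x) near_i.
by apply: filterS => y Hy; apply/polycylinderP.
Qed.

Lemma polycylinder_basis n (a : 'rV[C]_n) (P : set 'rV[C]_n) :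
  (\forall x \near a, P x) ->
  exists2 r : R, 0 < r & polycylinder a r `<=` P.
Proof.
move=> /nbhs_ballP[e /= e0 eP].
have er : e = ((complex.Re (e : R[i]))%:C)%C :> C.
  by rewrite RRe_real //; apply: gtr0_real.
exists (complex.Re (e : R[i])); first by rewrite -ltcR -er.
move=> x xa; apply: eP; split=> // i j; rewrite ord1 /ball /= distrC er;
  exact: xa.
Qed.

End Polycylinders.

Section NearbyHolomorphy.
Variable R : realType.
Local Notation C := (Cx R).
Implicit Types U V W : normedModType C.

(* Holomorphy on a neighbourhood is stable under composition pointwise, which
   avoids keeping track of domains. *)
Definition holo_at V W (X : charted V) (Y : charted W) (f : X -> Y) (x : X) :=
  \forall y \near x, cdiff_at f y.

Lemma holo_everywhere V W (X : charted V) (Y : charted W) (f : X -> Y) (x : X) :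
  (forall y, cdiff_at f y) -> holo_at f x.
Proof. by move=> H; exact: nearW. Qed.

Lemma holo_comp U V W (X : charted U) (Y : charted V) (T : charted W)
    (f : X -> Y) (g : Y -> T) x :
  holo_at f x -> holo_at g (f x) -> holo_at (g \o f) x.
Proof.
move=> hf hg; have [fc _] := nbhs_singleton hf.
by apply: filterS2 hf (fc _ hg) => y; exact: cdiff_at_comp.
Qed.

Lemma holo_fwd V (X : charted V) (c : chart X V) x : atlas c -> dom c x ->
  holo_at (Y := euclid V) (fwd c) x.
Proof. by move=> Ac cx; apply: filterS (near_dom cx) => y;
  exact: cdiff_fwd. Qed.

Lemma holo_bwd V (X : charted V) (c : chart X V) v : atlas c -> cod c v ->
  holo_at (X := euclid V) (bwd c) v.
Proof. by move=> Ac cv; apply: filterS (near_cod cv) => w;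
  exact: cdiff_bwd. Qed.

Lemma holo_pair U V W (X : charted U) (Y : charted V) (T : charted W)
    (f : X -> Y) (g : X -> T) x : holo_at f x -> holo_at g x ->
  holo_at (Y := prodc Y T) (fun y => (f y, g y)) x.
Proof. by move=> hf hg; apply: filterS2 hf hg => y; exact: cdiff_pair. Qed.

Lemma holo_fst V W (X : charted V) (Y : charted W) (q : prodc X Y) :
  holo_at (X := prodc X Y) (fun q : prodc X Y => q.1) q.
Proof. by apply: holo_everywhere => y; exact: cdiff_fst. Qed.

Lemma holo_snd V W (X : charted V) (Y : charted W) (q : prodc X Y) :
  holo_at (X := prodc X Y) (fun q : prodc X Y => q.2) q.
Proof. by apply: holo_everywhere => y; exact: cdiff_snd. Qed.

Lemma holo_cst V W (X : charted V) (w : W) x :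
  holo_at (Y := euclid W) (fun _ : X => w) x.
Proof. by apply: holo_everywhere => y; exact: cdiff_cst. Qed.

Lemma holoD V W (X : charted V) (f g : X -> W) x :
  holo_at (Y := euclid W) f x -> holo_at (Y := euclid W) g x ->
  holo_at (Y := euclid W) (fun y => f y + g y) x.
Proof. by move=> hf hg; apply: filterS2 hf hg => y; exact: cdiffD. Qed.

Lemma holoB V W (X : charted V) (f g : X -> W) x :
  holo_at (Y := euclid W) f x -> holo_at (Y := euclid W) g x ->
  holo_at (Y := euclid W) (fun y => f y - g y) x.
Proof. by move=> hf hg; apply: filterS2 hf hg => y; exact: cdiffB. Qed.

Lemma holo_submxrow V (X : charted V) p (m : 'I_p -> nat)
    (f : X -> 'rV[C]_(\sum_k m k)) k x :
  holo_at (Y := euclid 'rV[C]_(\sum_k m k)) f x ->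
  holo_at (Y := euclid 'rV[C]_(m k)) (fun y => submxrow (f y) k) x.
Proof.
apply: filterS => y /cdiff_rowP df; apply/cdiff_rowP => i.
suff -> : (fun y => submxrow (f y) k 0 i) = (fun y => f y 0 (tagnat.Rank k i)).
  exact: df.
by apply/funext => z; rewrite mxE.
Qed.

Lemma holo_mxrow V (X : charted V) p (m : 'I_p -> nat)
    (f : forall k, X -> 'rV[C]_(m k)) x :
  (forall k, holo_at (Y := euclid 'rV[C]_(m k)) (f k) x) ->
  holo_at (Y := euclid 'rV[C]_(\sum_k m k)) (fun y => \mxrow_k f k y) x.
Proof.
move=> hf; have : \forall y \near x, forall k, cdiff_at (Y :=
  euclid 'rV[C]_(m k)) (f k) y.
  exact: filter_forall.
apply: filterS => y df; apply/cdiff_rowP => i; under eq_fun do rewrite mxE.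
by have /cdiff_rowP := df (tagnat.sig1 i); apply.
Qed.

Lemma holo_lsubmx V (X : charted V) m n (f : X -> 'rV[C]_(m + n)) x :
  holo_at (Y := euclid 'rV[C]_(m + n)) f x ->
  holo_at (Y := euclid 'rV[C]_m) (fun y => lsubmx (f y)) x.
Proof.
apply: filterS => y /cdiff_rowP df; apply/cdiff_rowP => i.
suff -> : (fun y => lsubmx (f y) 0 i) = (fun y => f y 0 (lshift n i)).
  exact: df.
by apply/funext => z; rewrite mxE.
Qed.

Lemma holo_rsubmx V (X : charted V) m n (f : X -> 'rV[C]_(m + n)) x :
  holo_at (Y := euclid 'rV[C]_(m + n)) f x ->
  holo_at (Y := euclid 'rV[C]_n) (fun y => rsubmx (f y)) x.
Proof.
apply: filterS => y /cdiff_rowP df; apply/cdiff_rowP => i.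
suff -> : (fun y => rsubmx (f y) 0 i) = (fun y => f y 0 (rshift m i)).
  exact: df.
by apply/funext => z; rewrite mxE.
Qed.

Lemma holo_row_mx V (X : charted V) m n (f : X -> 'rV[C]_m) (g : X ->
  'rV[C]_n) x :
  holo_at (Y := euclid 'rV[C]_m) f x -> holo_at (Y := euclid 'rV[C]_n) g x ->
  holo_at (Y := euclid 'rV[C]_(m + n)) (fun y => row_mx (f y) (g y)) x.
Proof.
apply: filterS2 => y /cdiff_rowP df /cdiff_rowP dg; apply/cdiff_rowP => i.
under eq_fun do rewrite mxE.
by case: (fintype.split i) => k; [exact: df|exact: dg].
Qed.

End NearbyHolomorphy.

Section GraphCharts.
Variable R : realType.
Local Notation C := (Cx R).
Variables (dZ dS : nat) (Z : complex_manifold R dZ) (S : complex_manifold R dS).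
Variables (Phi : Z -> S) (hol_Phi : holomorphic Phi).
Variables (c : chart Z 'rV[C]_dZ) (d : chart S 'rV[C]_dS).
Hypothesis (Ac : atlas c).
Variables (v : 'rV[C]_dZ) (r : R).
Hypotheses (r_gt0 : 0 < r) (v_cod : polycylinder v r `<=` cod c)
  (v_base : forall x, polycylinder v r x -> dom d (Phi (bwd c x))).

Definition graph_dom : set Z := [set z | dom c z /\ polycylinder v r (fwd c z)].

Definition graph_map (z : Z) : affine_times S dZ := (fwd c z, Phi z).

Lemma bwd_graph_dom x : polycylinder v r x -> graph_dom (bwd c x).
Proof.
by move=> vx; split; [apply: bwd_fun|rewrite bwdK //]; exact: v_cod.
Qed.

Lemma graph_dom_base z : graph_dom z -> dom d (Phi z).
Proof. by move=> [cz vz]; have := v_base vz; rewrite fwdK. Qed.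

Lemma graph_dom_open : open graph_dom.
Proof.
rewrite openE => z [cz vz].
have H1 := near_dom cz.
have H2 : \forall y \near z, polycylinder v r (fwd c y).
  exact: (fwd_continuous cz (near_polycylinder vz)).
by apply: filterS2 H1 H2 => y.
Qed.

Lemma diff_near_id (V : normedModType C) (f : V -> V) x :
  (\forall y \near x, f y = y) -> 'd f x = id :> (V -> V).
Proof.
move=> fid; apply: (@diff_unique _ _ _ f idfun); first by move=> y;
  exact: cvg_id.
have fx : f x = x := nbhs_singleton fid.
apply/eqaddoP => e e0; have := fid; rewrite (near_shift 0 x) subr0.
apply: filterS => y; rewrite /= !fctE /= fx => ->.
by rewrite [x + y]addrC subrr normr0 mulr_ge0 // ltW.
Qed.

(** The first component of graph_map is a chart, whose inverse provides a left
    inverse of the differential. *)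
Lemma graph_immersion :
  immersion_on (Y := affine_times S dZ) graph_dom graph_map.
Proof.
move=> z [cz vz] c1 _ Ac1 [_ [d1 [-> Ad1 ->]]] c1z [_ d1z'].
have d1z : dom d1 (Phi z) by [].
set f := fwd _ \o _ \o _.
have df : differentiable f (fwd c1 z).
  apply: (@differentiable_pair _ _ _ _ (fwd c \o bwd c1) (fwd d1 \o Phi \o bwd
    c1)).
    exact: atlas_compat.
  by have [_ Phid] := @hol_Phi z I; exact: Phid.
pose g (q : 'rV[C]_dZ * 'rV[C]_dS) := fwd c1 (bwd c q.1).
have dg : differentiable g (f (fwd c1 z)).
  apply: (@differentiable_comp _ _ _ _ fst (fwd c1 \o bwd c)).
    by apply: (@linear_differentiable _ _ _ fst) => ?; exact: cvg_fst.
  have -> : (f (fwd c1 z)).1 = fwd c z by rewrite /f /= (fwdK c1z).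
  exact: (atlas_compat Ac Ac1).
have gf : \forall y \near fwd c1 z, (g \o f) y = y.
  have H1 := bwd_near c1z (near_dom cz).
  have H2 := near_cod (fwd_fun c1z).
  by apply: filterS2 H1 H2 => y cy c1y; rewrite /g /f /= fwdK // bwdK.
have := diff_near_id gf; rewrite diff_comp // => gfid u w uw.
by have := congr1 (fun h => h u) gfid; have := congr1 (fun h => h w) gfid;
  rewrite /= uw => -> ->.
Qed.

(** If (x, s) is in the closure of the image of F, then s = Phi (bwd c x)
    because S is Hausdorff, and bwd c x is in F because bwd c is continuous. *)
Lemma graph_closed (F : set Z) : closed F ->
  exists2 G : set (affine_times S dZ), closed G &
    graph_map @` (F `&` graph_dom) = G `&` (polycylinder v r `*` dom d).
Proof.
move=> Fc; set A := graph_map @` _.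
exists (closure A); first exact: closed_closure.
apply/seteqP; split.
  move=> q [z [Fz Uz] <-]; split; first by apply: subset_closure; exists z.
  by split; [case: Uz|exact: graph_dom_base].
move=> [x s] [Aq [/= vx ds]].
have cx := v_cod vx; have Ux := bwd_graph_dom vx.
have near_q (P : set Z) (Q : set S) : nbhs (bwd c x) P -> nbhs s Q ->
    exists y, [/\ F y, graph_dom y, P y & Q (Phi y)].
  move=> Px Qs.
  have nq : nbhs ((x, s) : affine_times S dZ) [set q | P (bwd c q.1) /\ Q q.2].
    by exists ((bwd c @^-1` P), Q) => /=; [split=> //;
      exact: (bwd_continuous cx Px)|case].
  have [_ [[y [Fy Uy] <-] /= [Py Qy]]] := Aq _ nq.
  by exists y; split=> //; case: Uy Py => cy _; rewrite fwdK.
exists (bwd c x); last first.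
  rewrite /graph_map bwdK //; congr (_, _).
  apply: contrapT => ns.
  have sn : s != Phi (bwd c x) by apply/eqP => sE; apply: ns.
  have := cm_hausdorff (c := S); rewrite open_hausdorff => /(_ _ _ sn).
  move=> [[P Q] /= [/set_mem Ps /set_mem Qx] [oP oQ /eqP PQ]].
  have [Phic _] := @hol_Phi (bwd c x) I.
  have Qn : nbhs (bwd c x) (Phi @^-1` Q) by apply: Phic; exact: open_nbhs_nbhs.
  have Pn : nbhs s P by exact: open_nbhs_nbhs.
  have [y [_ _ Qy Py]] := near_q _ _ Qn Pn.
  by have : (P `&` Q) (Phi y) by []; rewrite PQ.
split=> //; apply: Fc => N Nx.
by have [y [Fy _ Ny _]] := near_q N setT Nx filterT; exists y.
Qed.

Lemma graph_embedding : closed_embedding (Y := affine_times S dZ) graph_dom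
  (polycylinder v r `*` dom d) graph_map.
Proof.
split.
- by move=> z Uz; split; [case: Uz|exact: graph_dom_base].
- move=> z [cz _]; apply: cdiff_pair; first exact: cdiff_fwd.
  exact: hol_Phi.
- move=> y z /set_mem[cy _] /set_mem[cz _] [yz _].
  by rewrite -(fwdK cy) yz fwdK.
- exact: graph_immersion.
- exact: graph_closed.
Qed.

Definition graph_chart : rel_chart Phi dZ :=
  @RelChart R dZ dS Z S Phi dZ graph_dom v r (dom d) graph_map graph_dom_open
    r_gt0 (dom_open d) graph_dom_base graph_embedding (fun _ _ => erefl).

End GraphCharts.

(** * Intersections of graph charts *)

Section Intersections.
Variable R : realType.
Local Notation C := (Cx R).
Variables (dZ dS : nat) (Z : complex_manifold R dZ) (S : complex_manifold R dS).
Variables (Phi : Z -> S) (hol_Phi : holomorphic Phi).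
Variables (p : nat) (J : 'I_p.+1 -> rel_chart Phi dZ).
Variables (c : 'I_p.+1 -> chart Z 'rV[C]_dZ) (d : chart S 'rV[C]_dS)
  (w : chart Z 'rV[C]_dZ).
Hypotheses (Ac : forall k, atlas (c k)) (Ad : atlas d) (Aw : atlas w).

Local Notation N := (\sum_(k < p.+1) dZ)%N.
Local Notation l := (\sum_(k < p) dZ + dS)%N.
Local Notation Y := (affine_times S N).
Local Notation E := (euclid 'rV[C]_l).

Hypotheses
  (J_dom : forall k, rc_dom (J k) =
     [set z | dom (c k) z /\ rc_poly (J k) (fwd (c k) z)])
  (J_map : forall k z, rc_map (J k) z = (fwd (c k) z, Phi z))
  (J_cod : forall k, rc_poly (J k) `<=` cod (c k))
  (J_base : rc_base (J ord0) = dom d)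
  (J_common : forall k z, rc_dom (J k) z -> dom w z).

Local Notation m := (fun _ : 'I_p.+1 => dZ).
Local Notation U := (@inter_dom R dZ dS Z S Phi p m J).
Local Notation B := (@inter_poly R dZ dS Z S Phi p m J `*`
                     @inter_base R dZ dS Z S Phi p m J).
Local Notation j := (@inter_map R dZ dS Z S Phi p m J).

Let pt (k : 'I_p.+1) (y : Y) : Z := bwd (c k) (submxrow y.1 k).

(* A point y of the product comes from Z when all the pt k y agree, which the
   common chart w expresses by p * dZ equations, and when their image under Phi
   is the last component of y, which d expresses by dS equations. *)
Let equations (y : Y) : 'rV[C]_l :=
  row_mx (\mxrow_(k < p) (fwd w (pt (lift ord0 k) y) - fwd w (pt ord0 y)))
    (fwd d y.2 - fwd d (Phi (pt ord0 y))).

Let shift (k : 'I_p.+1) (u : 'rV[C]_l) : 'rV[C]_dZ :=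
  if unlift ord0 k is Some i then @submxrow _ p (fun _ =>
    dZ) 1 (lsubmx u) i else 0.

(* The block of index 0 is free: starting from pt ord0 y, the equations with
   right-hand side u are solved for the other blocks and the last component. *)
Let solve (q : prodc Y E) : Y :=
  (\mxrow_k fwd (c k) (bwd w (fwd w (pt ord0 q.1) + shift k q.2)),
   bwd d (fwd d (Phi (pt ord0 q.1)) + rsubmx q.2)).

Lemma inter_mapE z : j z = (\mxrow_k fwd (c k) z, Phi z).
Proof. by congr (_, _); apply/eq_mxrow => k; rewrite J_map. Qed.

Lemma pt_dom k y : B y -> rc_dom (J k) (pt k y).
Proof.
move=> [/= By _]; rewrite J_dom; split; first by apply: bwd_fun;
  exact: (J_cod (By k)).
by rewrite bwdK; [exact: By|exact: (J_cod (By k))].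
Qed.

Lemma fwd_pt k y : B y -> fwd (c k) (pt k y) = submxrow y.1 k.
Proof. by move=> [/= By _]; rewrite bwdK //; exact: (J_cod (By k)). Qed.

Lemma pt_inter_map k z : U z -> pt k (j z) = z.
Proof.
move=> Uz; rewrite inter_mapE /pt /= mxrowK fwdK //.
by have := Uz k I; rewrite J_dom => -[].
Qed.

Lemma inter_map_fun z : U z -> B (j z).
Proof.
move=> Uz; split=> /= k.
  by have := Uz k I; rewrite /inter_map /= mxrowK J_map J_dom => -[].
by move=> _; apply: rc_dom_base; exact: Uz.
Qed.

Lemma inter_dom_open : open U.
Proof.
rewrite openE => z Uz.
apply: (@filter_forall _ _ (fun k y => setT k -> rc_dom (J k) y)) => k.
have : \forall y \near z, rc_dom (J k) y.
  by apply: open_nbhs_nbhs; split; [exact: rc_dom_open|exact: Uz].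
exact: filterS.
Qed.

Lemma dom_c k z : rc_dom (J k) z -> dom (c k) z.
Proof. by rewrite J_dom => -[]. Qed.

Lemma base_Phi_pt y : B y -> dom d (Phi (pt ord0 y)).
Proof. by move=> /(pt_dom ord0) /rc_dom_base; rewrite J_base. Qed.

Lemma base_snd y : B y -> dom d y.2.
Proof. by move=> [_ By]; rewrite -J_base; exact: (By ord0 I). Qed.

Lemma holo_pt k y : B y -> holo_at (X := Y) (pt k) y.
Proof.
move=> [/= By _].
apply: (@holo_comp _ _ _ _ Y (euclid 'rV[C]_dZ) Z (fun y : Y =>
  submxrow y.1 k) (bwd (c k))).
  by apply: (@holo_submxrow _ _ Y _ m (fun y : Y => y.1) k); exact: holo_fst.
by apply: holo_bwd => //; exact: (J_cod (By k)).
Qed.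

Lemma holo_Phi z : holo_at Phi z.
Proof. by apply: holo_everywhere => y; exact: hol_Phi. Qed.

Lemma holo_w_pt k y : B y ->
  holo_at (X := Y) (Y := euclid 'rV[C]_dZ) (fun y => fwd w (pt k y)) y.
Proof.
move=> By; apply: (@holo_comp _ _ _ _ Y Z (euclid 'rV[C]_dZ) (pt k) (fwd w)).
  exact: holo_pt.
by apply: holo_fwd => //; exact: (J_common (pt_dom k By)).
Qed.

Lemma holo_d_Phi_pt y : B y ->
  holo_at (X := Y) (Y := euclid 'rV[C]_dS) (fun y => fwd d (Phi (pt ord0 y))) y.
Proof.
move=> By; apply: (@holo_comp _ _ _ _ Y Z (euclid 'rV[C]_dS) (pt ord0) (fwd d
  \o Phi)).
  exact: holo_pt.
apply: (@holo_comp _ _ _ _ Z S (euclid 'rV[C]_dS) Phi (fwd d));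
  first exact: holo_Phi.
by apply: holo_fwd => //; exact: base_Phi_pt.
Qed.

Lemma holo_equations y : B y -> holo_at (X := Y) (Y := E) equations y.
Proof.
move=> By; apply: (@holo_row_mx _ _ Y).
  apply: (@holo_mxrow _ _ Y p (fun=> dZ)
    (fun k y => fwd w (pt (lift ord0 k) y) - fwd w (pt ord0 y))) => k.
  by apply: (@holoB _ _ _ Y); exact: holo_w_pt.
apply: (@holoB _ _ _ Y _ (fun y => fwd d (Phi (pt ord0 y))));
  last exact: holo_d_Phi_pt.
apply: (@holo_comp _ _ _ _ Y S (euclid 'rV[C]_dS) (fun y : Y => y.2) (fwd d)).
  exact: holo_snd.
by apply: holo_fwd => //; exact: base_snd.
Qed.

Lemma equations_inter_map z : U z -> equations (j z) = 0.
Proof.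
move=> Uz.
have e1 : \mxrow_(k < p) (fwd w (pt (lift ord0 k) (j z)) - fwd w (pt ord0 (j
  z)))
    = 0 by apply/matrixP => i k; rewrite !mxE !pt_inter_map // subrr.
have e2 : (j z).2 = Phi z by rewrite inter_mapE.
by rewrite /equations e1 e2 pt_inter_map // subrr row_mx0.
Qed.

Lemma inter_map_equations y : B y -> equations y = 0 ->
  exists2 z, U z & y = j z.
Proof.
move=> By /eqP; rewrite row_mx_eq0 => /andP[/eqP e1 /eqP e2].
have pt_eq k : pt k y = pt ord0 y.
  case: (unliftP ord0 k) => [i ->|->//].
  have := congr1 (fun A => @submxrow _ p (fun _ => dZ) 1 A i) e1.
  rewrite mxrowK submxrow0 => /eqP; rewrite subr_eq0 => /eqP H.
  have w1 := J_common (pt_dom (lift ord0 i) By).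
  have w0 := J_common (pt_dom ord0 By).
  by rewrite -(fwdK w1) H fwdK.
have sE : y.2 = Phi (pt ord0 y).
  move/eqP: e2; rewrite subr_eq0 => /eqP H.
  by rewrite -(fwdK (base_snd By)) H fwdK //; exact: base_Phi_pt.
exists (pt ord0 y).
  by move=> k _; rewrite -(pt_eq k); exact: pt_dom.
rewrite inter_mapE -sE [LHS]surjective_pairing; congr (_, _).
rewrite -[LHS](@submxrowK _ _ m); apply/eq_mxrow => k.
by rewrite -(pt_eq k) fwd_pt.
Qed.

Lemma near_B z : U z -> \forall y \near j z, B y.
Proof.
move=> Uz; have [Bp Bs] := inter_map_fun Uz.
have near_poly k : \forall y \near j z, rc_poly (J k) (submxrow (y : Y).1 k).
  have hk : holo_at (X := Y) (Y :=
    euclid 'rV[C]_dZ) (fun y : Y => submxrow y.1 k) (j z).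
    by apply: (@holo_submxrow _ _ Y _ m (fun y : Y => y.1) k); exact: holo_fst.
  have [ck _] := nbhs_singleton hk.
  exact: (ck _ (near_polycylinder (Bp k))).
have near_base k : \forall y \near j z, rc_base (J k) (y : Y).2.
  have [ck _] := @cdiff_snd _ _ _ (euclid 'rV[C]_N) S (j z).
  apply: (ck (rc_base (J k))); apply: open_nbhs_nbhs.
  by split; [exact: rc_base_open|exact: (Bs k I)].
have H1 := @filter_forall _ _ (fun k (y : Y) => rc_poly (J k) (submxrow y.1 k))
  _ (nbhs_filter (j z)) near_poly.
have H2 := @filter_forall _ _ (fun k (y : Y) => rc_base (J k) y.2)
  _ (nbhs_filter (j z)) near_base.
by apply: filterS2 H1 H2 => y y1 y2; split=> //= k _.
Qed.

Lemma shift0 k : shift k 0 = 0.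
Proof.
by rewrite /shift; case: unlift => // i; rewrite linear0 submxrow0.
Qed.

Lemma solve_zero y : B y -> solve (y, 0) = j (pt ord0 y).
Proof.
move=> By; have w0 := J_common (pt_dom ord0 By).
rewrite inter_mapE /solve /= linear0 addr0 fwdK; last exact: base_Phi_pt.
by congr (_, _); apply/eq_mxrow => k; rewrite shift0 addr0 fwdK.
Qed.

Lemma solve_equations y : B y -> solve (y, equations y) = y.
Proof.
move=> By; rewrite /solve /= [RHS]surjective_pairing; congr (_, _); last first.
  by rewrite row_mxKr addrC subrK fwdK //; exact: base_snd.
rewrite -[RHS](@submxrowK _ _ m); apply/eq_mxrow => k; rewrite -fwd_pt //.
rewrite /shift; case: unliftP => [i ->|->].
  rewrite row_mxKl mxrowK addrC subrK fwdK //.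
  exact: (J_common (pt_dom _ By)).
by rewrite addr0 fwdK //; exact: (J_common (pt_dom _ By)).
Qed.

Lemma holo_solve z : U z -> holo_at (X := prodc Y E) solve (j z, 0).
Proof.
move=> Uz; have Bz := inter_map_fun Uz.
have ptz := pt_inter_map ord0 Uz.
have wz : dom w z := J_common (Uz ord0 I).
have dz : dom d (Phi z) by have := base_Phi_pt Bz; rewrite ptz.
have fst_y := @holo_fst _ _ _ Y E (j z, 0).
have snd_u := @holo_snd _ _ _ Y E (j z, 0).
apply: (@holo_pair _ _ _ _ (prodc Y E) (euclid 'rV[C]_N) S).
  apply: (@holo_mxrow _ _ (prodc Y E) _ m
    (fun k q => fwd (c k) (bwd w (fwd w (pt ord0 q.1) + shift k q.2)))) => k.
  pose g (q : prodc Y E) := fwd w (pt ord0 q.1) + shift k q.2.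
  have gz : g (j z, 0) = fwd w z by rewrite /g /= shift0 addr0 ptz.
  have hg : holo_at (X := prodc Y E) (Y := euclid 'rV[C]_dZ) g (j z, 0).
    apply: (@holoD _ _ _ (prodc Y E) (fun q => fwd w (pt ord0 q.1))).
      apply: (@holo_comp _ _ _ _ (prodc Y E) Y (euclid 'rV[C]_dZ)
        (fun q : prodc Y E => q.1) (fun y => fwd w (pt ord0 y))) => //.
      exact: holo_w_pt.
    rewrite /shift; case: unlift => [i|]; last exact: holo_cst.
    apply: (@holo_submxrow _ _ (prodc Y E) _ (fun=> dZ) (fun q : prodc Y E =>
      lsubmx q.2)).
    exact: (@holo_lsubmx _ _ (prodc Y E) _ _ (fun q : prodc Y E => q.2)).
  apply: (@holo_comp _ _ _ _ (prodc Y E) Z (euclid 'rV[C]_dZ) (bwd w \o g)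
    (fwd (c k))).
    apply: (@holo_comp _ _ _ _ (prodc Y E) (euclid 'rV[C]_dZ) Z g (bwd w)) =>
      //.
    by rewrite gz; apply: holo_bwd => //; exact: fwd_fun.
  rewrite /= gz fwdK //; apply: holo_fwd => //.
  exact: dom_c (Uz k I).
pose h (q : prodc Y E) := fwd d (Phi (pt ord0 q.1)) + rsubmx q.2.
have hz : h (j z, 0) = fwd d (Phi z) by rewrite /h /= linear0 addr0 ptz.
apply: (@holo_comp _ _ _ _ (prodc Y E) (euclid 'rV[C]_dS) S h (bwd d));
  last first.
  by rewrite hz; apply: holo_bwd => //; exact: fwd_fun.
apply: (@holoD _ _ _ (prodc Y E) (fun q => fwd d (Phi (pt ord0 q.1)))).
  apply: (@holo_comp _ _ _ _ (prodc Y E) Y (euclid 'rV[C]_dS)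
    (fun q : prodc Y E => q.1) (fun y => fwd d (Phi (pt ord0 y)))) => //.
  exact: holo_d_Phi_pt.
exact: (@holo_rsubmx _ _ (prodc Y E) _ _ (fun q : prodc Y E => q.2)).
Qed.

Lemma holo_inter_map z : U z -> holo_at (Y := Y) j z.
Proof.
move=> Uz.
have -> : j = (fun z => (\mxrow_k fwd (c k) z, Phi z)) by apply/funext => y;
  exact: inter_mapE.
apply: (@holo_pair _ _ _ _ Z (euclid 'rV[C]_N) S); last exact: holo_Phi.
apply: (@holo_mxrow _ _ Z _ m (fun k => fwd (c k))) => k.
by apply: holo_fwd => //; exact: dom_c (Uz k I).
Qed.

Lemma common_chart_complete_intersection :
  complete_intersection (Y := Y) U B j l.
Proof.
apply: (@complete_intersection_criterion _ _ _ Z Y U B j (pt ord0) l equations).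
- exact: inter_dom_open.
- by move=> z /holo_inter_map /nbhs_singleton [].
- by move=> y /holo_equations /nbhs_singleton.
- exact: equations_inter_map.
- exact: inter_map_equations.
- by move=> z Uz; apply: holo_pt; exact: inter_map_fun.
- by move=> z; exact: pt_inter_map.
- move=> z Uz; exists solve; split; first exact: holo_solve.
    by apply: filterS (near_B Uz) => y; exact: solve_equations.
  by apply: filterS (near_B Uz) => y; exact: solve_zero.
Qed.

End Intersections.

(** * Relative charts of a holomorphic map *)

Lemma codimension_count dZ dS p : (dS < dZ)%N ->
  (\sum_(k < p) dZ + dS + (dZ - dS) = \sum_(k < p.+1) dZ)%N.
Proof. by move=> /ltnW h; rewrite -addnA subnKC // big_ord_recl addnC. Qed.

Lemma local_data (R : realType) (dZ dS : nat) (Z : complex_manifold R dZ)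
    (S : complex_manifold R dS) (Phi : Z -> S) (hol_Phi : holomorphic Phi)
    (N : Z -> set Z) (z : Z) : nbhs z (N z) ->
  exists t : chart Z 'rV[Cx R]_dZ * chart S 'rV[Cx R]_dS * R,
    [/\ atlas t.1.1, atlas t.1.2, dom t.1.1 z, 0 < t.2 &
      forall x, polycylinder (fwd t.1.1 z) t.2 x ->
        [/\ cod t.1.1 x, N z (bwd t.1.1 x) & dom t.1.2 (Phi (bwd t.1.1 x))]].
Proof.
move=> Nz; have [c Ac cz] := atlas_cover z;
  have [d Ad dz] := atlas_cover (Phi z).
have [Phic _] := @hol_Phi z I.
have H1 := near_cod (fwd_fun cz).
have H2 := bwd_near cz Nz.
have H3 := bwd_near cz (Phic _ (near_dom dz)).
have H : \forall x \near fwd c z,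
    [/\ cod c x, N z (bwd c x) & dom d (Phi (bwd c x))].
  by apply: filterS3 H1 H2 H3.
have [r r0 rP] := polycylinder_basis H.
by exists (c, d, r).
Qed.

Theorem lemma3p2 (R : realType) (dZ dS : nat)
    (Z : complex_manifold R dZ) (S : complex_manifold R dS)
    (Phi : Z -> S) (hol_Phi : holomorphic Phi) (flat_Phi : flat_map hol_Phi)
    (n_gt0 : (dS < dZ)%N) :
  exists (rho : Z -> R) (m : Z -> nat) (B : Z -> set S)
         (j : forall z : Z, R -> rel_chart Phi (m z)),
    [/\ forall z, 0 < rho z,
        forall z r, 0 < r < rho z ->
          [/\ rc_radius (j z r) = r,
              rc_base (j z r) = B z,
              rc_dom (j z r) z,
              (rc_map (j z r) z).1 = rc_center (j z r) &
              set_bij (rc_dom (j z r)) (rc_poly (j z r))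
                (fun x => (rc_map (j z r) x).1)],
        forall z r r', 0 < r < rho z -> 0 < r' < rho z ->
          rc_map (j z r) z = rc_map (j z r') z &
        forall (p : nat) (z : 'I_p.+1 -> Z) (r : 'I_p.+1 -> R),
          (forall k, 0 < r k < rho (z k)) ->
          inter_complete_intersection (fun k => j (z k) (r k))].
Proof.
have atlas_open : [set A : set Z | exists2 c, atlas c & A = dom c] `<=` open.
  by move=> A [c _ ->]; exact: dom_open.
have atlas_covers : \bigcup_(A in [set A : set Z | exists2 c,
  atlas c & A = dom c]) A = setT.
  apply/seteqP; split=> // z _; have [c Ac cz] := atlas_cover z.
  by exists (dom c) => //; exists c.
have [N [Nz N_star]] := star_neighbourhoods (@cm_hausdorff _ _ Z)
  (@cm_paracompact _ _ Z) atlas_open atlas_covers.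
have [t tP] := choice (fun z => local_data hol_Phi (Nz z)).
pose c z := (t z).1.1; pose d z := (t z).1.2; pose rho z := (t z).2.
have chart_at (zr : Z * R) : exists J : rel_chart Phi dZ, 0 < zr.2 < rho zr.1 ->
    [/\ rc_radius J = zr.2, rc_base J = dom (d zr.1),
        rc_center J = fwd (c zr.1) zr.1,
        rc_map J = (fun x => (fwd (c zr.1) x, Phi x)) &
        rc_dom J = [set x | dom (c zr.1) x /\ rc_poly J (fwd (c zr.1) x)]].
  case: zr => z r /=; have [Ac Ad cz rho0 tin] := tP z.
  have make s : 0 < s <= rho z -> exists J : rel_chart Phi dZ,
    [/\ rc_radius J = s, rc_base J = dom (d z), rc_center J = fwd (c z) z,
        rc_map J = (fun x => (fwd (c z) x, Phi x)) &
        rc_dom J = [set x | dom (c z) x /\ rc_poly J (fwd (c z) x)]].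
    move=> /andP[s0 s_rho].
    have vcod : polycylinder (fwd (c z) z) s `<=` cod (c z).
      by move=> x /(polycylinder_mono s_rho) /tin[].
    have vbase x : polycylinder (fwd (c z) z) s x ->
      dom (d z) (Phi (bwd (c z) x)).
      by move=> /(polycylinder_mono s_rho) /tin[].
    by exists (graph_chart hol_Phi Ac s0 vcod vbase).
  (* Radii out of range are replaced by the largest admissible one. *)
  have [r_ok|nr] := boolP (0 < r <= rho z).
    by have [J JP] := make r r_ok; exists J.
  have [|J _] := make (rho z); first by rewrite rho0 lexx.
  by exists J => /andP[r0 r_rho]; case/negP: nr; rewrite r0 ltW.
have [J JP] := choice chart_at.
exists rho, (fun=> dZ), (fun z => dom (d z)), (fun z r => J (z, r)).
have J_in z r x : 0 < r < rho z -> rc_poly (J (z, r)) x ->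
    [/\ cod (c z) x, N z (bwd (c z) x) & dom (d z) (Phi (bwd (c z) x))].
  move=> rr; have [Jr _ Jc _ _] := JP (z, r) rr; have [_ _ _ _ tin] := tP z.
  rewrite /rc_poly Jr Jc => /(polycylinder_mono (ltW _)) H.
  by apply: tin; apply: H; case/andP: rr.
have J_center z r : 0 < r < rho z -> rc_dom (J (z, r)) z.
  move=> rr; have [Jr _ Jc _ ->] := JP (z, r) rr; have [_ _ cz _ _] := tP z.
  split=> //; rewrite /rc_poly Jr Jc; apply: polycylinder_center.
  by case/andP: rr.
split.
- by move=> z; have [] := tP z.
- move=> z r rr; have [Jr Jb Jc Jm Jd] := JP (z, r) rr; split=> //.
  + exact: J_center.
  + by rewrite Jm Jc.
  split.
  + by move=> x; rewrite Jd Jm => -[].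
  + move=> x y; rewrite Jd Jm => /set_mem[cx _] /set_mem[cy _] /= xy.
    by rewrite -(fwdK cx) xy fwdK.
  + move=> x Jx; have [cx _ _] := J_in z r x rr Jx.
    exists (bwd (c z) x); last by rewrite Jm /= bwdK.
    by rewrite Jd; split; [exact: bwd_fun|rewrite /= bwdK].
- move=> z r r' rr rr'.
  have [_ _ _ -> _] := JP (z, r) rr; have [_ _ _ -> _] := JP (z, r') rr'.
  by [].
move=> p z r rr.
exists (\sum_(k < p) dZ + dS)%N; first exact: codimension_count.
pose JJ k := J (z k, r k).
have [[x Ux]|empty] := pselect (exists x, inter_dom JJ x); last first.
  (* The domain of each chart contains its center, so that an empty intersection
     involves at least two charts; there is then at least one equation, and the
     equations 1 = 0 define the empty set. *)
  have -> : inter_dom JJ = set0.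
    by apply/seteqP; split=> // x Ux; case: empty; exists x.
  apply: complete_intersection_empty;
    case: (p) z r rr @JJ empty => [|p'] z' r' rr' JJ empty.
    case: empty; exists (z' ord0) => k _; rewrite /JJ (ord1 k); exact: J_center.
  by rewrite big_ord_recl addn_gt0 addn_gt0 (leq_trans _ n_gt0).
have JN k y : rc_dom (JJ k) y -> N (z k) y.
  have [_ _ _ _ ->] := JP (z k, r k) (rr k) => -[cy Jy].
  by have [_ ] := J_in _ _ _ (rr k) Jy; rewrite fwdK.
(* All the domains contain x, so that they lie in the domain of one chart w. *)
have [_ [w Aw ->] w_star] := N_star x.
apply: (@common_chart_complete_intersection _ _ _ _ _ Phi hol_Phi p JJ
  (fun k => c (z k)) (d (z ord0)) w) => //.
- by move=> k; have [] := tP (z k).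
- by have [] := tP (z ord0).
- by move=> k; have [_ _ _ _ ->] := JP (z k, r k) (rr k).
- by move=> k y; have [_ _ _ -> _] := JP (z k, r k) (rr k).
- by move=> k y Jy; have [] := J_in _ _ _ (rr k) Jy.
- by have [_ -> _ _ _] := JP (z ord0, r ord0) (rr ord0).
- move=> k y Jy; apply: (w_star (z k)); last exact: JN Jy.
  exact: JN (Ux k I).
Qed.
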